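(* Let $n\ge 0$ and assume that $\bar h^{n,C}_{ij}\ge 0$ and $\bar h^{n,D}_{ij}\ge 0$ for all $i,j$. Let the cell averages at the next time level be given by $$\begin{aligned} \bar h^{n+1,C}_{ij}={}&(1-\theta)\,\bar h^{n,C}_{ij}+\frac{\theta}{\Delta x\Delta y}\int_{C_{ij}}h^{n,D}\,dx\,dy\\ &-\frac{\Delta t_n}{2\Delta x}\sum_{m=1}^{2}\sum_{\alpha=1}^{N}\omega_\alpha\Big[(h^{n,D}u^{n,D})\big(x_{i+\frac12},y_j^{m,\alpha}\big)-(h^{n,D}u^{n,D})\big(x_{i-\frac12},y_j^{m,\alpha}\big)\Big]\\ &-\frac{\Delta t_n}{2\Delta y}\sum_{l=1}^{2}\sum_{\alpha=1}^{N}\omega_\alpha\Big[(h^{n,D}v^{n,D})\big(x_i^{l,\alpha},y_{j+\frac12}\big)-(h^{n,D}v^{n,D})\big(x_i^{l,\alpha},y_{j-\frac12}\big)\Big] \end{aligned}$$ and by the counterpart on the dual mesh $$\begin{aligned} \bar h^{n+1,D}_{ij}={}&(1-\theta)\,\bar h^{n,D}_{ij}+\frac{\theta}{\Delta x\Delta y}\int_{D_{ij}}h^{n,C}\,dx\,dy\\ &-\frac{\Delta t_n}{2\Delta x}\sum_{\alpha=1}^{N}\omega_\alpha\sum_{y\in\{y_{j-1}^{2,\alpha},\,y_j^{1,\alpha}\}}\Big[(h^{n,C}u^{n,C})(x_i,y)-(h^{n,C}u^{n,C})(x_{i-1},y)\Big]\\ &-\frac{\Delta t_n}{2\Delta y}\sum_{\alpha=1}^{N}\omega_\alpha\sum_{x\in\{x_{i-1}^{2,\alpha},\,x_i^{1,\alpha}\}}\Big[(h^{n,C}v^{n,C})(x,y_j)-(h^{n,C}v^{n,C})(x,y_{j-1})\Big].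 \end{aligned}$$ If $h^{n,C}(x,y)\ge 0$ and $h^{n,D}(x,y)\ge 0$ for all $(x,y)\in L^{l,m}_{i,j}$, for all $i,j$ and $l,m\in\{1,2\}$, then $\bar h^{n+1,C}_{ij}\ge 0$ and $\bar h^{n+1,D}_{ij}\ge 0$ for all $i,j$, under the CFL condition $$\lambda_x a_x+\lambda_y a_y\le \tfrac14\,\theta\,\hat\omega_1,$$ where $\lambda_x=\Delta t_n/\Delta x$, $\lambda_y=\Delta t_n/\Delta y$, $a_x=\max(\|u^{n,C}\|_\infty,\|u^{n,D}\|_\infty)$ and $a_y=\max(\|v^{n,C}\|_\infty,\|v^{n,D}\|_\infty)$.
   Context: **Meshes.** $\{x_i\}_i$ and $\{y_j\}_j$ are uniform partitions with spacings $\Delta x>0$, $\Delta y>0$. Put $x_{i+\frac12}=\frac12(x_i+x_{i+1})$, $y_{j+\frac12}=\frac12(y_j+y_{j+1})$. The primal cells are $C_{ij}=[x_{i-\frac12},x_{i+\frac12}]\times[y_{j-\frac12},y_{j+\frac12}]$ and the dual cells are $D_{ij}=[x_{i-1},x_i]\times[y_{j-1},y_j]$; the two meshes overlap. The data on all cells appearing in the formulas are assumed available (at the boundary of the domain they are supplied by boundary conditions and treated like the other cells). **Discrete functions.** Fix an integer $k\ge1$. $h^{n,C}$ (resp. $h^{n,D}$) is the water depth at time $t_n$, a piecewise polynomial of degree at most $k$ on each $C_{ij}$ (resp. $D_{ij}$), possibly discontinuous across cell boundaries. $u^{n,C},v^{n,C}$ (resp. $u^{n,D},v^{n,D}$) are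 the velocity components, which are continuous functions whose restriction to each $C_{ij}$ (resp. $D_{ij}$) is a polynomial of degree at most $k$. $\bar h^{n,C}_{ij}$ (resp. $\bar h^{n,D}_{ij}$) is the average of $h^{n,C}$ over $C_{ij}$ (resp. of $h^{n,D}$ over $D_{ij}$). $\Delta t_n>0$ is the time step, and $\theta=\Delta t_n/\tau\in[0,1]$, where $\tau>0$ is the maximal time step allowed by the scheme's CFL restriction. **Quadrature.** $\{\hat x_i^{1,\beta}\}_{\beta=1}^{\hat N}$ and $\{\hat x_i^{2,\beta}\}_{\beta=1}^{\hat N}$ are the Legendre Gauss–Lobatto points (endpoints included, in increasing order) on $[x_{i-\frac12},x_i]$ and $[x_i,x_{i+\frac12}]$; their sets are denoted $\hat L_i^{1,x},\hat L_i^{2,x}$. Similarly $\hat L_j^{1,y}=\{\hat y_j^{1,\beta}\}$ and $\hat L_j^{2,y}=\{\hat y_j^{2,\beta}\}$ on $[y_{j-\frac12},y_j]$ and $[y_j,y_{j+\frac12}]$. The corresponding weights on $[-\frac12,\frac12]$ are $\hat\omega_\beta$, $\beta=1,\dots,\hat N$ (so they sum to 1), with $\hat N\geq 2$ chosen so that $2\hat N-3\ge k$. $L_i^{1,x}=\{x_i^{1,\alpha}\}_{\alpha=1}^N$, $L_i^{2,x}=\{x_i^{2,\alpha}\}_{\alpha=1}^N$ are the Gauss(–Legendre) points on $[x_{i-\frac12},x_i]$, $[x_i,x_{i+\frac12}]$, and $L_j^{1,y}=\{y_j^{1,\alpha}\}$, $L_j^{2,y}=\{y_j^{2,\alpha}\}$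 those on $[y_{j-\frac12},y_j]$, $[y_j,y_{j+\frac12}]$, with weights $\omega_\alpha$ on $[-\frac12,\frac12]$ (summing to 1), and $N$ chosen so that the rule is exact for univariate polynomials of degree $2k+1$. For $l,m\in\{1,2\}$, $$L^{l,m}_{i,j}=(L_i^{l,x}\times\hat L_j^{m,y})\cup(\hat L_i^{l,x}\times L_j^{m,y}).$$ These points lie in the closed quarter of $C_{ij}$ with $x$-half $l$ and $y$-half $m$. This quarter is contained in exactly one primal and one dual cell, and the values of $h^{n,C}$ and $h^{n,D}$ at points of $L^{l,m}_{i,j}$ are those of the polynomials on these cells (one-sided values from this quarter). *)

(* Defs.v *)
From HB Require Import structures.
From mathcomp Require Import all_boot all_order all_algebra.
From mathcomp Require Import all_classical all_reals all_analysis.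

Set Implicit Arguments.
Unset Strict Implicit.
Unset Printing Implicit Defensive.
Import Order.TTheory GRing.Theory Num.Theory.
Import numFieldNormedType.Exports.
Local Open Scope classical_set_scope.
Local Open Scope ring_scope.

(** * Legendre quadrature on [-1/2, 1/2] *)

Section Quadrature.
Context {R : realType}.
Implicit Types (z : seq R) (p : {poly R}).

(* Rodrigues' formula. *)
Definition legendre (n : nat) : {poly R} :=
  (2 ^+ n * n`!%:R)^-1 *: (('X^2 - 1) ^+ n)^`(n).

(* The Legendre polynomials live on [-1, 1], whence the factor 2. *)
Definition gauss_legendre_nodes (N : nat) z : Prop :=
  [/\ size z = N, sorted <%R z &
      forall t, (t \in z) = root (legendre N) (2 * t)].

Definition gauss_lobatto_nodes (N : nat) z : Prop :=
  [/\ size z = N, sorted <%R z &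
      forall t, (t \in z) = [|| t == - 2^-1, t == 2^-1
                              | root (legendre N.-1)^`() (2 * t)]].

Definition lagrange_poly z (a : nat) : {poly R} :=
  \prod_(b < size z | b != a :> nat) ((z`_a - z`_b)^-1 *: ('X - (z`_b)%:P)).

(* Weight of the [a]-th node, counted from 0, in the interpolatory rule. *)
Definition weight z (a : nat) : R :=
  \int[lebesgue_measure]_(t in `[- 2^-1, 2^-1]) (lagrange_poly z a).[t].

Definition quadrature_exact z (d : nat) : Prop :=
  forall p, (size p <= d.+1)%N ->
    \sum_(a < size z) weight z a * p.[z`_a] =
    \int[lebesgue_measure]_(t in `[- 2^-1, 2^-1]) p.[t].

End Quadrature.

(** * Overlapping Cartesian meshes *)

Record uniform_grid (R : Type) := UniformGrid { origin : R; spacing : R }.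

Section Grid.
Context {R : realType}.
Implicit Types (X : uniform_grid R) (i : int) (l : bool).

Definition node X i : R := origin X + i%:~R * spacing X.

(* The point with index [i + 1/2]; the one with index [i - 1/2] is
   [midnode X (i - 1)]. *)
Definition midnode X i : R := (node X i + node X (i + 1)) / 2.

(* Endpoints of the first ([l = false], superscript 1) or second
   ([l = true], superscript 2) half of the primal interval of index [i]. *)
Definition half_left X i l : R := if l then node X i else midnode X (i - 1).
Definition half_right X i l : R := if l then midnode X i else node X i.

(* Image of t in [-1/2, 1/2] under the affine map onto that half. *)
Definition half_point X i l (t : R) : R :=
  (half_left X i l + half_right X i l) / 2
  + (half_right X i l - half_left X i l) * t.

Definition half_nodes X (z : seq R) i l : set R :=
  [set x | x \in [seq half_point X i l t | t <- z]].

Definition primal_index X (x : R) : int :=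
  Num.floor ((x - origin X) / spacing X + 2^-1).
Definition dual_index X (x : R) : int :=
  Num.floor ((x - origin X) / spacing X) + 1.

End Grid.

Section Mesh.
Context {R : realType}.
Variables X Y : uniform_grid R.
Implicit Types (i j : int) (l m : bool) (h : int -> int -> {poly {poly R}}).
Implicit Types (u v : R * R -> R) (z : seq R) (A : set (R * R)).

Definition primal_cell i j : set (R * R) :=
  `[midnode X (i - 1), midnode X i] `*` `[midnode Y (j - 1), midnode Y j].
Definition dual_cell i j : set (R * R) :=
  `[node X (i - 1), node X i] `*` `[node Y (j - 1), node Y j].

(* A piecewise polynomial is given by one bivariate polynomial per cell.
   Below, its value on a cell edge is taken from the cell to the right or
   above.  This choice is immaterial: edges are null sets, and the functions
   [primal_fun] and [dual_fun] are only evaluated pointwise at flux points,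
   which are interior to the relevant cell. *)
Definition primal_fun h (q : R * R) : R :=
  (h (primal_index X q.1) (primal_index Y q.2)).[q.1, q.2].
Definition dual_fun h (q : R * R) : R :=
  (h (dual_index X q.1) (dual_index Y q.2)).[q.1, q.2].

(* The quarter (l, m) of the primal cell (i, j) lies in this dual cell. *)
Definition dual_of_half i l : int := i + (l : nat)%:Z.

(* One-sided values from the quarter (l, m) of the primal cell (i, j). *)
Definition primal_value h i j (q : R * R) : R := (h i j).[q.1, q.2].
Definition dual_value h i j l m (q : R * R) : R :=
  (h (dual_of_half i l) (dual_of_half j m)).[q.1, q.2].

Definition integral2 A (f : R * R -> R) : R :=
  \int[(lebesgue_measure \x lebesgue_measure)%E]_(q in A) f q.

Definition cell_average A (f : R * R -> R) : R :=
  integral2 A f / (spacing X * spacing Y).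

(* The set L^{l,m}_{i,j}; [z] are Gauss-Legendre and [zh] Gauss-Lobatto
   nodes. *)
Definition quadrature_set z zh i j l m : set (R * R) :=
  (half_nodes X z i l `*` half_nodes Y zh j m)
  `|` (half_nodes X zh i l `*` half_nodes Y z j m).

Definition primal_update z (theta dt : R) hC hD uD vD i j : R :=
  (1 - theta) * cell_average (primal_cell i j) (primal_fun hC)
  + theta / (spacing X * spacing Y)
    * integral2 (primal_cell i j) (dual_fun hD)
  - dt / (2 * spacing X) *
    (\sum_(m : bool) \sum_(a < size z) weight z a *
      (let F x := let q := (x, half_point Y j m z`_a) in
                  dual_fun hD q * uD q in
       F (midnode X i) - F (midnode X (i - 1))))
  - dt / (2 * spacing Y) *
    (\sum_(l : bool) \sum_(a < size z) weight z a *
      (let G y := let q := (half_point X i l z`_a, y) in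
                  dual_fun hD q * vD q in
       G (midnode Y j) - G (midnode Y (j - 1)))).

(* The halves of the dual interval of index [i] are the second half of the
   primal interval [i - 1] and the first half of the primal interval [i]. *)
Definition dual_half_point (Z : uniform_grid R) i (l : bool) (t : R) : R :=
  if l then half_point Z i false t else half_point Z (i - 1) true t.

Definition dual_update z (theta dt : R) hC hD uC vC i j : R :=
  (1 - theta) * cell_average (dual_cell i j) (dual_fun hD)
  + theta / (spacing X * spacing Y)
    * integral2 (dual_cell i j) (primal_fun hC)
  - dt / (2 * spacing X) *
    (\sum_(a < size z) weight z a * \sum_(m : bool)
      (let F x := let q := (x, dual_half_point Y j m z`_a) in
                  primal_fun hC q * uC q in
       F (node X i) - F (node X (i - 1))))
  - dt / (2 * spacing Y) *
    (\sum_(a < size z) weight z a * \sum_(l : bool)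
      (let G y := let q := (dual_half_point X i l z`_a, y) in
                  primal_fun hC q * vC q in
       G (node Y j) - G (node Y (j - 1)))).

End Mesh.

(** * Discrete functions *)

Section DiscreteFunctions.
Context {R : realType}.

Definition total_degree_le (k : nat) (p : {poly {poly R}}) : Prop :=
  forall a b : nat, (k < a + b)%N -> p`_a`_b = 0.

Definition cells_union (cell : int -> int -> set (R * R))
    (I : set (int * int)) : set (R * R) :=
  \bigcup_(ij in I) cell ij.1 ij.2.

Definition continuous_piecewise_poly (k : nat)
    (cell : int -> int -> set (R * R)) (I : set (int * int))
    (u : R * R -> R) : Prop :=
  {within cells_union cell I, continuous u} /\
  forall i j, I (i, j) -> exists2 p : {poly {poly R}},
    total_degree_le k p & forall q, cell i j q -> u q = p.[q.1, q.2].

Definition sup_norm (A : set (R * R)) (u : R * R -> R) : \bar R :=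
  ereal_sup [set `|u q|%:E | q in A].

End DiscreteFunctions.

(* [IC] and [ID] index the primal and dual cells that carry data, ghost cells
   included.  A cell can be updated when it and the four cells of the other
   mesh that it overlaps carry data. *)
Definition primal_updatable (IC ID : set (int * int)) (i j : int) : Prop :=
  IC (i, j) /\
  forall l m : bool, ID (dual_of_half i l, dual_of_half j m).
Definition dual_updatable (IC ID : set (int * int)) (i j : int) : Prop :=
  ID (i, j) /\
  forall l m : bool, IC (i - (l : nat)%:Z, j - (m : nat)%:Z).

(* Main.v *)
(* The average of a piecewise polynomial over a cell is the mean of its averages
   over the four quarters that the cell shares with the cells of the other mesh.
   On a quarter, the tensor product of an N-point Gauss rule and a Gauss-Lobatto
   rule is exact, and since all weights are nonnegative and all values at the
   nodes are nonnegative, the average is at least \hat\omega_1 times the Gauss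
   sum over the outer edge of the quarter.  The fluxes involve only these edge
   sums, multiplied by velocities bounded by a_x or a_y, so the CFL condition
   leaves a nonnegative contribution on every quarter.

   Exactness and positivity of the two rules follow from the orthogonality of
   the derivatives of (t^2 - 1/4)^n to polynomials of low degree. *)

Require Import Defs.
From HB Require Import structures.
From mathcomp Require Import all_boot all_order all_algebra.
From mathcomp Require Import all_classical all_reals all_analysis.
From mathcomp Require Import measurable_realfun ring lra zify.

Import Order.TTheory GRing.Theory Num.Theory.
Import numFieldNormedType.Exports.
Local Open Scope classical_set_scope.
Local Open Scope ring_scope.

Set Implicit Arguments.
Unset Strict Implicit.
Unset Printing Implicit Defensive.

(** * Integrals of polynomials *)

Section PolyIntegral.
Context {R : realType}.
Implicit Types (p q : {poly R}) (a b c : R).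

Definition poly_int a b p : R := \int[lebesgue_measure]_(t in `[a, b]) p.[t].

Lemma poly_int_deriv a b q : a < b -> poly_int a b q^`() = q.[b] - q.[a].
Proof.
move=> ab; rewrite /poly_int /Rintegral (@continuous_FTC2 _ _ (horner q))//.
- exact/continuous_subspaceT/continuous_horner.
- split=> [x _| |].
  + exact: derivable_horner.
  + exact/cvg_at_right_filter/continuous_horner.
  + exact/cvg_at_left_filter/continuous_horner.
- by move=> x _; rewrite -derivE.
Qed.

(** Combined with [poly_int_deriv], this turns linearity, substitution and reflection into
    identities between boundary values, free of integrability side conditions. *)
Lemma antiderivative p : exists q, p = q^`().
Proof.
(* At [i = 0] the division by zero makes the constant coefficient [0]. *)
exists (\poly_(i < (size p).+1) (p`_i.-1 / i%:R)); apply/polyP => i.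
rewrite coef_deriv coef_poly ltnS; case: ltnP => [_|szp].
  by rewrite -[RHS]mulr_natr divfK// pnatr_eq0.
by rewrite mul0rn nth_default.
Qed.

Lemma poly_intD a b p q : a < b ->
  poly_int a b (p + q) = poly_int a b p + poly_int a b q.
Proof.
move=> ab; have [P ->] := antiderivative p; have [Q ->] := antiderivative q.
by rewrite -derivD !poly_int_deriv// !hornerD; ring.
Qed.

Lemma poly_intZ a b c p : a < b -> poly_int a b (c *: p) = c * poly_int a b p.
Proof.
move=> ab; have [P ->] := antiderivative p.
by rewrite -derivZ !poly_int_deriv// !hornerZ; ring.
Qed.

Lemma poly_int_sum a b (I : Type) (r : seq I) (F : I -> {poly R}) : a < b ->
  poly_int a b (\sum_(i <- r) F i) = \sum_(i <- r) poly_int a b (F i).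
Proof.
move=> ab; elim/big_ind2: _ => [|p x q y <- <-|//]; last exact: poly_intD.
by rewrite -(scale0r 0) poly_intZ// mul0r.
Qed.

Lemma poly_int_by_parts a b p q : a < b ->
  poly_int a b (p^`() * q) =
  (p * q).[b] - (p * q).[a] - poly_int a b (p * q^`()).
Proof. by move=> ab; rewrite -poly_int_deriv// derivM poly_intD// addrK. Qed.

Lemma poly_int_affine a b c (r : R) p : a < b -> 0 < r ->
  poly_int (c + r * a) (c + r * b) p =
  r * poly_int a b (p \Po (c%:P + r *: 'X)).
Proof.
move=> ab r0; have [P ->] := antiderivative p.
rewrite poly_int_deriv ?ltrD2l ?ltr_pM2l// -poly_intZ//.
have -> : r *: (P^`() \Po (c%:P + r *: 'X)) = (P \Po (c%:P + r *: 'X))^`().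
  by rewrite deriv_comp derivD derivC add0r derivZ derivX -mul_polyC mulr1
             mulrC mul_polyC.
by rewrite poly_int_deriv// !horner_comp !hornerE.
Qed.

Lemma poly_int_reflect a p : 0 < a ->
  poly_int (- a) a (p \Po (- 'X)) = poly_int (- a) a p.
Proof.
move=> a0; have aa : - a < a by lra.
have [P ->] := antiderivative p; rewrite [RHS]poly_int_deriv//.
have -> : P^`() \Po - 'X = (- (P \Po - 'X))^`().
  by rewrite derivN deriv_comp derivN derivX mulrN1 opprK.
by rewrite poly_int_deriv// !hornerN !horner_comp !hornerN !hornerX !opprK;
  ring.
Qed.

Lemma poly_eq0_itv a b p : a < b ->
  (forall x, a <= x <= b -> p.[x] = 0) -> p = 0.
Proof.
move=> ab p0; apply/eqP/negPn/negP => p_neq0.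
(* [size p] equally spaced points of the interval: one more than the number of roots a nonzero
   polynomial of this size can have. *)
pose s := [seq a + (b - a) * (i%:R / (size p)%:R) | i <- iota 0 (size p)].
have szp : 0 < (size p)%:R :> R by rewrite ltr0n size_poly_gt0.
suff : (size s < size p)%N by rewrite size_map size_iota ltnn.
apply: max_poly_roots => //.
  apply/allP => _ /mapP[i + ->]; rewrite mem_iota add0n => /andP[_ ilt].
  apply/eqP/p0.
  have : 0 <= (i%:R / (size p)%:R : R) <= 1.
    by rewrite divr_ge0//= ler_pdivrMr// mul1r ler_nat ltnW.
  by move: (i%:R / _) => t; nra.
rewrite map_inj_uniq ?iota_uniq// => i j.
move=> /addrI/mulfI; rewrite subr_eq0 gt_eqF// => /(_ isT).
by move=> /(divIf (lt0r_neq0 szp))/eqP; rewrite eqr_nat => /eqP.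
Qed.

(** By the mean value theorem an antiderivative [P] is nondecreasing on the interval. Were the
    integral not positive, [P] would be constant there, hence constant as a polynomial, and [p]
    would be zero. *)
Lemma poly_int_gt0 a b p : a < b -> p != 0 ->
  (forall x, a <= x <= b -> 0 <= p.[x]) -> 0 < poly_int a b p.
Proof.
move=> ab + p_ge0; have [P Pp] := antiderivative p; rewrite Pp => p_neq0.
have mono x y : a <= x -> x <= y -> y <= b -> P.[x] <= P.[y].
  move=> ax; rewrite le_eqVlt => /predU1P[-> //|xy] yb; rewrite -subr_ge0.
  have [|c + ->] := @MVT R (horner P) (horner P^`()) x y xy (fun t _ => _).
    exact/continuous_subspaceT/continuous_horner.
  rewrite in_itv/= -Pp => /andP[xc cy].
  by rewrite mulr_ge0 ?subr_ge0 ?(ltW xy)// p_ge0//; lra.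
rewrite poly_int_deriv// subr_gt0 ltNge; apply: contra p_neq0 => Pba.
suff -> : P = P.[a]%:P by rewrite derivC.
apply/eqP; rewrite -subr_eq0; apply/eqP/(poly_eq0_itv ab) => x /andP[ax xb].
rewrite !hornerE; apply/eqP; rewrite subr_eq0 eq_le (mono a)//.
by rewrite (le_trans _ Pba)// mono.
Qed.

End PolyIntegral.

(** * Gauss-Legendre and Gauss-Lobatto rules *)

Section InterpolatoryRules.
Context {R : realType}.
Implicit Types (p q : {poly R}) (z : seq R).

Local Notation J := (poly_int (- 2^-1) 2^-1).

Definition quadrature z p : R := \sum_(a < size z) weight z a * p.[z`_a].

Lemma half_itv : - 2^-1 < 2^-1 :> R. Proof. lra. Qed.

Lemma lagrange_poly_nth z a b : uniq z -> (a < size z)%N -> (b < size z)%N ->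
  (lagrange_poly z a).[z`_b] = (a == b)%:R.
Proof.
move=> uz ltaz ltbz; rewrite /lagrange_poly horner_prod.
have [<-|neq_ab] := eqVneq a b.
  rewrite big1// => c neq_ca; rewrite !hornerE mulVf// subr_eq0.
  by rewrite nth_uniq// eq_sym.
rewrite (bigD1 (Ordinal ltbz)) 1?eq_sym//=.
by rewrite !hornerE subrr mulr0 mul0r.
Qed.

Lemma size_lagrange_poly z a : (a < size z)%N ->
  (size (lagrange_poly z a) <= size z)%N.
Proof.
move=> ltaz; apply: leq_trans (size_prod_leq _ _) _.
have cardP : #|[pred b : 'I_(size z) | b != a :> nat]| = (size z).-1.
  by rewrite -[in RHS](card_ord (size z)) -(cardC1 (Ordinal ltaz));
    apply: eq_card.
have : (\sum_(b < size z | b != a :> nat)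
    size ((z`_a - z`_b)^-1 *: ('X - (z`_b)%:P))
  <= \sum_(b < size z | b != a :> nat) 2)%N.
  by apply: leq_sum => b _; rewrite (leq_trans (size_scale_leq _ _))//
    size_XsubC.
rewrite sum_nat_const cardP; set s := (\sum_(b < _ | _) _)%N => les;
  rewrite -/s; lia.
Qed.

Lemma lagrange_interpolation z p : uniq z -> (size p <= size z)%N ->
  p = \sum_(a < size z) p.[z`_a] *: lagrange_poly z a.
Proof.
move=> uz szp; apply/eqP; rewrite -subr_eq0; apply/eqP.
apply: (@roots_geq_poly_eq0 _ _ z) => //; last first.
  rewrite (leq_trans (size_polyD _ _))// geq_max szp size_polyN.
  rewrite (leq_trans (size_sum _ _ _))//; apply/bigmax_leqP => a _.
  by rewrite (leq_trans (size_scale_leq _ _))// size_lagrange_poly.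
apply/(all_nthP 0) => b ltbz; rewrite /root !hornerE horner_sum.
rewrite (bigD1 (Ordinal ltbz))//= big1 => [|a neq_ab].
  by rewrite !hornerE lagrange_poly_nth// eqxx mulr1 subrr.
move: neq_ab; rewrite -val_eqE !hornerE lagrange_poly_nth// => /negbTE ->.
by rewrite mulr0.
Qed.

(* Division by the nodal polynomial reduces the claim to polynomials of degree
   less than the number of nodes, which are equal to their interpolant. *)
Lemma quadrature_orthogonal z m : uniq z ->
  (forall q, (size q <= m)%N -> J ((\prod_(x <- z) ('X - x%:P)) * q) = 0) ->
  forall p, (size p <= size z + m)%N -> quadrature z p = J p.
Proof.
move=> uz orth p szp; have half := half_itv.
set w := (\prod_(x <- z) ('X - x%:P)) in orth.
have szw : size w = (size z).+1 by rewrite size_prod_XsubC.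
have w_neq0 : w != 0 by rewrite -size_poly_gt0 szw.
have low q : (size q <= size z)%N -> quadrature z q = J q.
  move=> szq; rewrite [in RHS](lagrange_interpolation uz szq) poly_int_sum//.
  by apply: eq_bigr => a _; rewrite poly_intZ// mulrC.
rewrite [in RHS](divp_eq p w) poly_intD// [X in J X]mulrC orth ?add0r;
  last first.
  by rewrite size_divp// szw/= leq_subLR.
rewrite -low; last by rewrite -ltnS -szw ltn_modp.
apply: eq_bigr => a _; rewrite [in LHS](divp_eq p w) hornerD hornerM.
suff -> : w.[z`_a] = 0 by rewrite mulr0 add0r.
by apply/rootP; rewrite root_prod_XsubC mem_nth.
Qed.

(** Test polynomials that vanish at all nodes but one isolate a single weight. The signs of the
    weights and the positions of the nodes are obtained in this way. *)
Lemma quadrature_single z p a : (a < size z)%N ->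
  (forall b, (b < size z)%N -> b != a -> p.[z`_b] = 0) ->
  quadrature z p = weight z a * p.[z`_a].
Proof.
move=> ltaz p0; rewrite /quadrature (bigD1 (Ordinal ltaz))//= big1 ?addr0// =>
  b ba.
by rewrite p0 ?mulr0.
Qed.

End InterpolatoryRules.

(** * Legendre polynomials on [-1/2, 1/2] and their orthogonality *)

Section Rodrigues.
Context {R : realType}.
Implicit Types (p q : {poly R}) (c t : R) (n : nat).

Local Notation J := (poly_int (- 2^-1) 2^-1).
Local Notation B := ('X^2 - (4^-1)%:P : {poly R}).

(** A nonzero multiple of the Legendre polynomial transported to [-1/2, 1/2]. No normalization is
    kept, since only roots and orthogonality matter. *)
Definition rodrigues n : {poly R} := (B ^+ n)^`(n).

Lemma derivn_comp_scale p c n :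
  (p \Po (c *: 'X))^`(n) = c ^+ n *: (p^`(n) \Po (c *: 'X)).
Proof.
elim: n => [|n IHn]; first by rewrite !derivn0 expr0 scale1r.
rewrite !derivnS IHn derivZ deriv_comp derivZ derivX alg_polyC.
by rewrite [_ * c%:P]mulrC mul_polyC scalerA exprSr.
Qed.

Lemma legendre_comp n :
  exists2 c, c != 0 & legendre n \Po (2 *: 'X) = c *: rodrigues n.
Proof.
(* The first factor is the normalization of [legendre], [(2 ^+ n)^-1] undoes the [n] chain rule
   factors, and [4 ^+ n] comes from (2t)^2 - 1 = 4 (t^2 - 1/4). *)
exists ((2 ^+ n * n`!%:R)^-1 * ((2 ^+ n)^-1 * 4 ^+ n)).
  by rewrite !mulf_neq0 ?invr_eq0 ?mulf_neq0 ?expf_neq0 ?pnatr_eq0 -?lt0n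
    ?fact_gt0.
rewrite /legendre comp_polyZ -scalerA; congr (_ *: _).
have := derivn_comp_scale (('X^2 - 1) ^+ n) 2 n.
move/(congr1 (fun r => (2 ^+ n)^-1 *: r)).
rewrite scalerA mulVf ?expf_neq0 ?pnatr_eq0// scale1r => <-.
rewrite -scalerA; congr (_ *: _); rewrite /rodrigues -derivnZ -exprZn
  rmorphXn/=.
congr ((_ ^+ _)^`(_)).
rewrite comp_polyB comp_polyC comp_Xn_poly exprZn scalerBr; congr (_ *: _ - _).
  by ring.
by rewrite -mul_polyC -polyCM mulfV// pnatr_eq0.
Qed.

Lemma root_legendre n t : root (legendre n) (2 * t) = root (rodrigues n) t.
Proof.
have [c c0 Lc] := legendre_comp n.
by rewrite -[in RHS](rootZ _ _ c0) -Lc /root horner_comp !hornerE.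
Qed.

Lemma root_legendre_deriv n t :
  root (legendre n)^`() (2 * t) = root (rodrigues n)^`() t.
Proof.
have [c c0 /(congr1 (fun p => 2^-1 *: p^`()))] := legendre_comp n.
rewrite deriv_comp !derivZ derivX alg_polyC mulrC mul_polyC !scalerA.
rewrite mulVf ?pnatr_eq0// scale1r => Lc.
have c0' : 2^-1 * c != 0 by rewrite mulf_neq0// invr_eq0 pnatr_eq0.
by rewrite -[in RHS](rootZ _ _ c0') -Lc /root horner_comp !hornerE.
Qed.

Lemma size_rodrigues n : size (rodrigues n) = n.+1.
Proof.
have monB : B ^+ n \is monic by rewrite monic_exp// monicXnsubC.
have szB : size (B ^+ n) = n.*2.+1.
  rewrite -(prednK (n := size _)) ?size_poly_gt0 ?monic_neq0//.
  by rewrite size_exp size_XnsubC// mul2n.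
apply/eqP; rewrite eqn_leq; apply/andP; split.
  apply/leq_sizeP => i lti; rewrite coef_derivn nth_default ?mul0rn// szB.
  by rewrite -addnn -addnS leq_add2l.
rewrite ltnNge; apply/negP => /leq_sizeP/(_ n (leqnn _))/eqP.
(* The coefficient of degree [n] is the leading coefficient [1] of [B ^+ n] times a falling
   factorial, nonzero in characteristic zero. *)
rewrite coef_derivn addnn; have -> : (B ^+ n)`_n.*2 = 1.
  by move/monicP: monB; rewrite lead_coefE szB.
by rewrite pnatr_eq0 eqn0Ngt ffact_gt0 -addnn leq_addr.
Qed.

(** [B] is even, and each of the [n] derivatives changes the parity. *)
Lemma rodrigues_reflect n : rodrigues n \Po (- 'X) = (-1) ^+ n *: rodrigues n.
Proof.
have := derivn_comp_scale (B ^+ n) (-1) n; rewrite scaleN1r => /esym.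
move/(congr1 (fun r => (-1) ^+ n *: r)).
rewrite scalerA -exprMn mulN1r opprK expr1n scale1r => ->.
congr (_ *: (_ ^`(_))); rewrite rmorphXn/= comp_polyB comp_polyC comp_Xn_poly.
by rewrite sqrrN.
Qed.

Lemma B_end0 : (B.[2^-1] = 0) * (B.[- 2^-1] = 0).
Proof. by split; rewrite !hornerE; field. Qed.

(** Each derivative removes at most one factor [b]; hence derivatives of order less than [n] vanish
    at the roots of [b]. *)
Lemma derivn_exp_dvd (b : {poly R}) n j : (j <= n)%N ->
  exists r, (b ^+ n)^`(j) = b ^+ (n - j) * r.
Proof.
elim: j => [_|j IHj ltjn]; first by exists 1; rewrite subn0 mulr1.
have [r rE] := IHj (ltnW ltjn).
exists ((b^`() *+ (n - j)) * r + b * r^`()).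
rewrite derivnS rE derivM deriv_exp -(subnSK ltjn) exprS/=.
by rewrite -!mulrnAl; ring.
Qed.

(* Each integration by parts has no boundary term, because the derivatives of
   order less than n of (t^2 - 1/4)^n vanish at both end points. *)
Lemma derivn_orthogonal n j q : (j <= n)%N -> (size q <= j)%N ->
  J ((B ^+ n)^`(j) * q) = 0.
Proof.
have half := @half_itv R.
elim: j q => [|j IHj] q ltjn szq.
  have -> : q = 0 by apply/eqP; rewrite -size_poly_leq0.
  by rewrite mulr0 -(scale0r 0) poly_intZ// mul0r.
rewrite derivnS poly_int_by_parts// IHj ?(ltnW ltjn)//; last first.
  have [->|q0] := eqVneq q 0; first by rewrite deriv0 size_poly0.
  by rewrite -ltnS (leq_trans (lt_size_deriv q0)).
have [r ->] := derivn_exp_dvd B (ltnW ltjn).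
by rewrite !hornerM !horner_exp !B_end0 expr0n subn_eq0 leqNgt ltjn !mul0r
  !subr0.
Qed.

Lemma rodrigues_orthogonal n q : (size q <= n)%N -> J (rodrigues n * q) = 0.
Proof. exact: derivn_orthogonal. Qed.

(** Integrate by parts: the factor [B] kills the boundary terms, and the derivative of [B * q] has
    size at most [n], so [rodrigues n] is orthogonal to it. *)
Lemma rodrigues_deriv_orthogonal n q : (size q < n)%N ->
  J (B * (rodrigues n)^`() * q) = 0.
Proof.
move=> szq; have half := @half_itv R.
rewrite [B * _]mulrC -mulrA poly_int_by_parts// rodrigues_orthogonal.
  by rewrite !hornerM !B_end0 !mul0r !mulr0 !subr0.
have [->|q0] := eqVneq q 0; first by rewrite mulr0 deriv0 size_poly0.
have B0 : B != 0 by rewrite monic_neq0// monicXnsubC.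
rewrite -ltnS (leq_trans (lt_size_deriv _)) ?mulf_neq0//.
by rewrite size_mul// size_XnsubC//=; lia.
Qed.

End Rodrigues.

(** * Signs of weights, location of nodes, and the Gauss-Legendre rule *)

Section GaussRules.
Context {R : realType}.
Implicit Types (p q : {poly R}) (z : seq R).

Local Notation J := (poly_int (- 2^-1) 2^-1).
Local Notation B := ('X^2 - (4^-1)%:P : {poly R}).

(** By exactness the weight times the nonnegative value of [p] at the node equals the integral of
    [p], which is positive. *)
Lemma weight_gt0 z d p a :
  (forall q, (size q <= d)%N -> quadrature z q = J q) -> (size p <= d)%N ->
  p != 0 -> (forall x, - 2^-1 <= x <= 2^-1 -> 0 <= p.[x]) ->
  (a < size z)%N -> - 2^-1 <= z`_a <= 2^-1 ->
  (forall b, (b < size z)%N -> b != a -> p.[z`_b] = 0) -> 0 < weight z a.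
Proof.
move=> exact_z szp p0 p_ge0 lta za p_other.
have := poly_int_gt0 (@half_itv R) p0 p_ge0.
rewrite -exact_z// (quadrature_single lta)// => w_gt0.
by rewrite -(pmulr_lgt0 _ (x := p.[z`_a])) // lt_neqAle p_ge0// andbT;
   apply: contraTneq w_gt0 => <-; rewrite mulr0 ltxx.
Qed.

(* If the node [z_a] lay outside of the open interval, [p * ('X - z_a)] would
   have a constant sign on it although the rule integrates it to [0]. *)
Lemma node_interior z d p a :
  (forall q, (size q <= d)%N -> quadrature z q = J q) -> (size p < d)%N ->
  p != 0 -> (forall x, - 2^-1 <= x <= 2^-1 -> 0 <= p.[x]) ->
  (a < size z)%N ->
  (forall b, (b < size z)%N -> b != a -> p.[z`_b] = 0) ->
  - 2^-1 < z`_a < 2^-1.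
Proof.
move=> exact_z szp p0 p_ge0 lta p_other.
have Jp0 : J (p * ('X - (z`_a)%:P)) = 0.
  rewrite -exact_z; last first.
    by rewrite size_mul ?polyXsubC_eq0// size_XsubC addn2.
  rewrite (quadrature_single lta) ?hornerM ?hornerXsubC ?subrr ?mulr0//.
  by move=> b ltb ba; rewrite hornerM p_other// mul0r.
have pX0 : p * ('X - (z`_a)%:P) != 0 by rewrite mulf_neq0// polyXsubC_eq0.
have J_neq0 q :
    q != 0 -> (forall x, - 2^-1 <= x <= 2^-1 -> 0 <= q.[x]) -> J q <> 0.
  by move=> q0 q_ge0 Jq0; have := poly_int_gt0 (@half_itv R) q0 q_ge0;
    rewrite Jq0 ltxx.
apply/andP; split; rewrite ltNge; apply/negP => za.
  apply: (J_neq0 _ pX0) => // x xI.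
  by rewrite hornerM hornerXsubC mulr_ge0 ?p_ge0//; lra.
apply: (J_neq0 (- (p * ('X - (z`_a)%:P)))); first by rewrite oppr_eq0.
  move=> x xI; rewrite hornerN hornerM hornerXsubC -mulrN mulr_ge0 ?p_ge0//.
  by lra.
by rewrite -[X in poly_int _ _ X]scaleN1r poly_intZ ?half_itv// Jp0 mulr0.
Qed.

(** The [N] distinct nodes are roots of [rodrigues N], which has degree [N]; so it splits into the
    corresponding linear factors. *)
Lemma legendre_nodal N z : gauss_legendre_nodes N z -> uniq z /\
  exists2 c, c != 0 & \prod_(x <- z) ('X - x%:P) = c *: rodrigues N.
Proof.
case=> szz /(sorted_uniq lt_trans ltxx) uz zP; split=> //.
have lc0 : lead_coef (@rodrigues R N) != 0.
  by rewrite lead_coef_eq0 -size_poly_gt0 size_rodrigues.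
exists (lead_coef (@rodrigues R N))^-1; first by rewrite invr_eq0.
rewrite [X in _ *: X](@all_roots_prod_XsubC _ _ z) ?size_rodrigues ?szz//.
- by rewrite scalerA mulVf// scale1r.
- by apply/allP => t; rewrite zP root_legendre.
- by rewrite uniq_rootsE.
Qed.

Lemma gauss_legendre_exact N z p : gauss_legendre_nodes N z ->
  (size p <= N + N)%N -> quadrature z p = J p.
Proof.
move=> gz; have [szz _ _] := gz; have [uz [c c0 zc]] := legendre_nodal gz.
rewrite -{1}szz; apply: quadrature_orthogonal => // q szq.
by rewrite zc -scalerAl poly_intZ ?half_itv// rodrigues_orthogonal// mulr0.
Qed.

(** The test polynomial is the square of the Lagrange polynomial of the node. Its degree is at most
    2N - 2, which leaves room for the additional linear factor in [node_interior]. *)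
Lemma gauss_legendre_node N z a : gauss_legendre_nodes N z -> (a < size z)%N ->
  (- 2^-1 < z`_a < 2^-1) /\ 0 < weight z a.
Proof.
move=> gz lta; have [szz _ _] := gz; have [uz _] := legendre_nodal gz.
set l := lagrange_poly z a.
have la : l.[z`_a] = 1 by rewrite lagrange_poly_nth// eqxx.
have l0 : l != 0 by apply: contra_eq_neq la => ->;
  rewrite horner0 eq_sym oner_eq0.
have szl : (size (l ^+ 2) < N + N)%N.
  have := size_lagrange_poly lta; have := l0; rewrite -/l szz -size_poly_gt0.
  by rewrite expr2 size_mul//; move: (size l) => s; lia.
have l2 : l ^+ 2 != 0 by rewrite expf_neq0.
have lge x : - 2^-1 <= x <= 2^-1 -> 0 <= (l ^+ 2).[x].
  by move=> _; rewrite horner_exp sqr_ge0.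
have lother b : (b < size z)%N -> b != a -> (l ^+ 2).[z`_b] = 0.
  move=> ltb ba; rewrite horner_exp lagrange_poly_nth// eq_sym (negbTE ba).
  by rewrite expr0n.
have zN q : (size q <= N + N)%N -> quadrature z q = J q.
  exact: gauss_legendre_exact.
have za := node_interior zN szl l2 lge lta lother.
split=> //; apply: (weight_gt0 zN (ltnW szl)) => //.
by case/andP: za => *; rewrite !ltW.
Qed.

End GaussRules.

(** * The Gauss-Lobatto rule with n + 1 nodes *)

Section LobattoRules.
Context {R : realType}.
Variables (n : nat) (z : seq R).
Hypotheses (n_gt0 : (0 < n)%N) (z_lobatto : gauss_lobatto_nodes n.+1 z).
Implicit Types (p q : {poly R}).

Local Notation J := (poly_int (- 2^-1) 2^-1).
Local Notation B := ('X^2 - (4^-1)%:P : {poly R}).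
Local Notation D := (@rodrigues R n)^`().

Let size_z : size z = n.+1. Proof. by case: z_lobatto. Qed.

Let uniq_z : uniq z.
Proof. by case: z_lobatto => _ /(sorted_uniq lt_trans ltxx). Qed.

Let size_D : size D = n.
Proof.
apply/eqP; rewrite eqn_leq; apply/andP; split.
  rewrite -ltnS -[X in (_ < X)%N](@size_rodrigues R) lt_size_deriv//.
  by rewrite -size_poly_gt0 size_rodrigues.
rewrite -(prednK n_gt0) ltnNge; apply/negP => /leq_sizeP/(_ n.-1 (leqnn _))/eqP.
rewrite coef_deriv prednK// mulrn_eq0 eqn0Ngt n_gt0/=.
have := lead_coef_eq0 (@rodrigues R n); rewrite lead_coefE size_rodrigues/= =>
  ->.
by rewrite -size_poly_eq0 size_rodrigues.
Qed.

Let D_neq0 : D != 0. Proof. by rewrite -size_poly_gt0 size_D. Qed.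

Let B_neq0 : B != 0. Proof. by rewrite monic_neq0// monicXnsubC. Qed.

Let B_root x : root B x = (x == - 2^-1) || (x == 2^-1).
Proof.
rewrite /root.
have -> : B.[x] = (x + 2^-1) * (x - 2^-1) by rewrite !hornerE; field.
by rewrite mulf_eq0 addr_eq0 subr_eq0.
Qed.

Let mem_z x : (x \in z) = root B x || root D x.
Proof.
have [_ _ ->] := z_lobatto.
by rewrite /= root_legendre_deriv B_root orbA.
Qed.

(** The nodal polynomial is proportional to [B * D], of degree n + 1, and is orthogonal to all
    polynomials of size at most n - 1. This gives exactness up to degree 2n - 1, that is 2(n + 1) -
    3. *)
Lemma lobatto_exact p : (size p <= n.*2)%N -> quadrature z p = J p.
Proof.
move=> szp; have szBD : size (B * D) = n.+2.
  by rewrite size_mul// size_XnsubC// size_D.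
apply: (@quadrature_orthogonal _ _ n.-1); rewrite ?size_z//; last by lia.
move=> q szq; have c0 : lead_coef (B * D) != 0 by rewrite lead_coef_eq0
  mulf_neq0.
apply: (mulfI c0); rewrite mulr0 -poly_intZ ?half_itv// scalerAl.
rewrite -all_roots_prod_XsubC ?szBD ?size_z ?uniq_rootsE//.
  by rewrite rodrigues_deriv_orthogonal//; lia.
by apply/allP => x; rewrite mem_z rootM.
Qed.

(** Divide [D] by its linear factor at the node to get [r]. The test polynomial [- B * r ^+ 2] is
    nonnegative on the interval and vanishes at the end points and at the other roots of [D]; its
    degree is 2n - 2. *)
Let D_interior a : (a < size z)%N -> root D z`_a ->
  (- 2^-1 < z`_a < 2^-1) /\ 0 < weight z a.
Proof.
move=> lta /factor_theorem[r rE].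
have r0 : r != 0 by apply: contraNneq D_neq0 => r0; rewrite rE r0 mul0r.
have szr : size r = n.-1.
  by move: size_D; rewrite rE size_mul ?polyXsubC_eq0// size_XsubC addn2 => <-.
have p0 : - B * r ^+ 2 != 0 by rewrite mulf_neq0 ?oppr_eq0 ?expf_neq0.
have p_ge0 x : - 2^-1 <= x <= 2^-1 -> 0 <= (- B * r ^+ 2).[x].
  move=> /andP[x1 x2]; rewrite hornerM horner_exp mulr_ge0 ?sqr_ge0//.
  by rewrite !hornerE; nra.
have p_other b : (b < size z)%N -> b != a -> (- B * r ^+ 2).[z`_b] = 0.
  move=> ltb ba; have : z`_b \in z by rewrite mem_nth.
  rewrite mem_z => /orP[/rootP Bb|]; first by rewrite hornerM hornerN Bb oppr0
    mul0r.
  rewrite rE rootM root_XsubC nth_uniq// (negbTE ba) orbF => /rootP rb.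
  by rewrite hornerM horner_exp rb expr0n mulr0.
have szp : (size (- B * r ^+ 2)%R < n.*2)%N.
  have := r0; rewrite -size_poly_gt0 szr => n1.
  rewrite size_mul ?oppr_eq0 ?expf_neq0// size_polyN size_XnsubC//.
  by rewrite expr2 size_mul// szr; lia.
have za := node_interior lobatto_exact szp p0 p_ge0 lta p_other.
split=> //; apply: (weight_gt0 lobatto_exact (ltnW szp) p0 p_ge0) => //.
by case/andP: za => *; rewrite !ltW.
Qed.

(** The end points are nodes, so a root of [D] there would contradict [D_interior]. *)
Let D_end : (D.[- 2^-1] != 0) * (D.[2^-1] != 0).
Proof.
by split; apply/negP => Dx;
  [have : - 2^-1 \in z by rewrite mem_z B_root eqxx
  |have : 2^-1 \in z by rewrite mem_z B_root eqxx orbT];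
  move=> /(nthP 0)[a lta za];
  have [] := D_interior lta; rewrite za // ltxx ?andbF.
Qed.

Lemma lobatto_node a : (a < size z)%N -> - 2^-1 <= z`_a <= 2^-1.
Proof.
move=> lta; have : z`_a \in z by rewrite mem_nth.
rewrite mem_z B_root => /orP[/orP[] /eqP ->|/(D_interior lta)[/andP[? ?] _]].
- by rewrite lexx; lra.
- by rewrite lexx andbT; lra.
- by rewrite !ltW.
Qed.

Lemma lobatto_first : z`_0 = - 2^-1.
Proof.
have : - 2^-1 \in z by rewrite mem_z B_root eqxx.
have [_ z_sorted _] := z_lobatto.
move=> /(nthP 0)[a lta za]; apply/eqP; rewrite eq_le.
have /andP[-> _] : - 2^-1 <= z`_0 <= 2^-1 by apply: lobatto_node;
  rewrite size_z.
rewrite andbT -za.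
by rewrite (lt_sorted_leq_nth 0 z_sorted)// inE size_z.
Qed.

Lemma lobatto_last : z`_n = 2^-1.
Proof.
have : 2^-1 \in z by rewrite mem_z B_root eqxx orbT.
have [_ z_sorted _] := z_lobatto.
move=> /(nthP 0)[a lta za]; apply/eqP; rewrite eq_le.
have /andP[_ ->] : - 2^-1 <= z`_n <= 2^-1 by apply: lobatto_node;
  rewrite size_z.
rewrite -za.
by rewrite (lt_sorted_leq_nth 0 z_sorted)// ?inE ?size_z// -ltnS -size_z.
Qed.

(** At interior nodes this is [D_interior]. At an end point the test polynomial is [D ^+ 2] times
    the linear factor, up to sign, that vanishes at the opposite end point; its degree is 2n - 1. *)
Lemma lobatto_weight_gt0 a : (a < size z)%N -> 0 < weight z a.
Proof.
move=> lta; have : z`_a \in z by rewrite mem_nth.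
have p0 c : ('X - c%:P) * D ^+ 2 != 0 by rewrite mulf_neq0 ?polyXsubC_eq0
  ?expf_neq0.
have szp c : (size (('X - c%:P) * D ^+ 2)%R <= n.*2)%N.
  rewrite size_mul ?polyXsubC_eq0 ?expf_neq0// size_XsubC.
  by rewrite expr2 size_mul// size_D; lia.
(* Here [- c] is the end point whose weight is isolated, and [c] the opposite one. *)
have other c b : (b < size z)%N -> z`_b != - c -> c = 2^-1 \/ c = - 2^-1 ->
  (('X - c%:P) * D ^+ 2).[z`_b] = 0.
  move=> ltb zbc ce; have : z`_b \in z by rewrite mem_nth.
  rewrite mem_z B_root => /orP[|/rootP Db]; last first.
    by rewrite hornerM horner_exp Db expr0n mulr0.
  rewrite hornerM hornerXsubC; case: ce zbc => ->; rewrite ?opprK => /negbTE ->.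
    by rewrite /= => /eqP ->; rewrite subrr mul0r.
  by rewrite orbF => /eqP ->; rewrite addNr mul0r.
rewrite mem_z B_root => /orP[/orP[] /eqP za|/(D_interior lta)[]//].
  apply: (weight_gt0 lobatto_exact (p := - (('X - (2^-1)%:P) * D ^+ 2))) => //.
  - by rewrite size_polyN.
  - by rewrite oppr_eq0.
  - move=> x /andP[x1 x2]; rewrite hornerN hornerM hornerXsubC horner_exp
    -mulNr.
    by rewrite mulr_ge0 ?sqr_ge0//; lra.
  - exact: lobatto_node.
  - move=> b ltb ba; rewrite hornerN other ?oppr0//; last by left.
    by rewrite -za nth_uniq.
apply: (weight_gt0 lobatto_exact (szp (- 2^-1))) => //.
- move=> x /andP[x1 x2]; rewrite hornerM hornerXsubC horner_exp.
  by rewrite mulr_ge0 ?sqr_ge0//; lra.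
- exact: lobatto_node.
- move=> b ltb ba; rewrite other//; last by right.
  by rewrite opprK -za nth_uniq.
Qed.

(* The rule integrates the odd polynomial [t * D(t)^2] to [0], and only the
   two end points contribute to the sum. *)
Lemma lobatto_weight_sym : weight z n = weight z 0.
Proof.
have D_reflect : D \Po (- 'X) = (-1) ^+ n.+1 *: D.
  have /(congr1 deriv) := @rodrigues_reflect R n.
  rewrite deriv_comp derivN derivX mulrN1 derivZ => /eqP;
    rewrite eqr_oppLR => /eqP ->.
  by rewrite exprS mulN1r scaleNr.
have Jp : J ('X * D ^+ 2) = 0.
  have /eqP : J ('X * D ^+ 2) = - J ('X * D ^+ 2).
    rewrite -[LHS]poly_int_reflect ?invr_gt0// rmorphM rmorphXn/= comp_polyX.
    rewrite D_reflect exprZn -exprM mulnC exprM sqrrN expr1n expr1n scale1r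
      mulNr.
    by rewrite -[X in poly_int _ _ X]scaleN1r poly_intZ ?half_itv// mulN1r.
  by rewrite -subr_eq0 opprK -mulr2n mulrn_eq0 => /eqP.
have D_sym : D.[- 2^-1] ^+ 2 = D.[2^-1] ^+ 2.
  have := congr1 (fun p => p.[2^-1] ^+ 2) D_reflect.
  by rewrite /= horner_comp hornerN hornerX hornerZ exprMn -exprM mulnC exprM
             sqrrN expr1n expr1n mul1r.
have szp : (size ('X * D ^+ 2)%R <= n.*2)%N.
  rewrite size_mul ?polyX_eq0 ?expf_neq0// size_polyX expr2 size_mul// size_D.
  by lia.
have := lobatto_exact szp; rewrite Jp /quadrature size_z.
have n0 : (ord0 : 'I_n.+1) != ord_max by rewrite -val_eqE/= eq_sym -lt0n.
rewrite (bigD1 ord_max)//= (bigD1 ord0)//= big1 ?addr0; last first.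
  move=> [b ltb] /andP[bn b0]; have : z`_b \in z by rewrite mem_nth// size_z.
  rewrite mem_z B_root -lobatto_first -lobatto_last !nth_uniq ?size_z//.
  move: bn b0; rewrite -!val_eqE/= => /negbTE -> /negbTE -> /= /rootP Db.
  by rewrite hornerM horner_exp Db expr0n !mulr0.
rewrite !hornerM !hornerX -!expr2 lobatto_first lobatto_last D_sym.
have D0 : D.[2^-1] ^+ 2 != 0 by rewrite expf_neq0// D_end.
move=> /eqP; rewrite mulNr mulrN subr_eq0 => /eqP/mulIf; apply.
by rewrite mulf_neq0// invr_eq0 pnatr_eq0.
Qed.

End LobattoRules.

(** * Tensor rules on rectangles *)

Section BivariateIntegral.
Context {R : realType}.
Implicit Types (p : {poly R}) (z : seq R) (P : {poly {poly R}}).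
Implicit Types (A B : set (measurableTypeR R)).

Local Notation mu := (@lebesgue_measure R).
Local Notation mu2 := (mu \x mu)%E.

Lemma measurable_horner2 P :
  measurable_fun [set: measurableTypeR R * measurableTypeR R]
    (fun q => P.[q.1, q.2]).
Proof.
elim/poly_ind: P => [|P c IHP].
  by under eq_fun do rewrite !horner0; exact: measurable_cst.
under eq_fun do rewrite hornerMXaddC hornerD hornerM hornerC.
apply: measurable_funD; first by apply: measurable_funM.
by apply: measurableT_comp => //; exact: measurable_poly.
Qed.

Lemma bounded_horner p (M : R) : exists K, forall x, `|x| <= M -> `|p.[x]| <= K.
Proof.
elim/poly_ind: p => [|p c [K pK]]; first by exists 0 => x _;
  rewrite horner0 normr0.
exists (K * M + `|c|) => x xM; rewrite hornerMXaddC.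
rewrite (le_trans (ler_normD _ _))// lerD2r normrM ler_pM//; exact: pK.
Qed.

Lemma bounded_horner2 P (M : R) : exists K, forall x y,
  `|x| <= M -> `|y| <= M -> `|P.[x, y]| <= K.
Proof.
elim/poly_ind: P => [|P c [K PK]]; first by exists 0 => x y _ _;
  rewrite !horner0 normr0.
have [L cL] := bounded_horner c M.
exists (K * M + L) => x y xM yM; rewrite hornerMXaddC hornerD hornerM hornerC.
by rewrite (le_trans (ler_normD _ _))// lerD ?cL// normrM ler_pM// PK.
Qed.

(** A polynomial is measurable, and bounded on a box of finite measure. *)
Lemma integrable_horner2 P (a b c d : R) A B :
  measurable A -> measurable B -> A `<=` `[a, b] -> B `<=` `[c, d] ->
  mu2.-integrable (A `*` B) (fun q => (P.[q.1, q.2])%:E).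
Proof.
move=> mA mB Aab Bcd.
have box : (A `*` B) `<=` `[a, b] `*` `[c, d].
  by move=> t [/Aab ? /Bcd ?].
apply: (@integrableS _ _ _ mu2 _ _ _ _ _ box); [exact: measurableX|exact:
  measurableX|].
apply: measurable_bounded_integrable; first exact: measurableX.
- rewrite [ltLHS](_ : _ = mu `[a, b] * mu `[c, d])%E;
  last exact: product_measure1E.
  rewrite !lebesgue_measure_itv/=.
  by case: ifP => _; case: ifP => _; rewrite ?mul0e ?mule0 ?ltry// -!EFinB
    -EFinM ltry.
- by apply: measurable_funTS; exact: measurable_horner2.
- have [K PK] := bounded_horner2 P (`|a| + `|b| + `|c| + `|d|).
  exists K; split; first exact: num_real.
  move=> L KL [x y] [/=]; rewrite !in_itv/= => xab ycd;
    rewrite (le_trans _ (ltW KL))//.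
  have Hn (u v w : R) : v <= u <= w -> `|u| <= `|v| + `|w|.
    move=> /andP[vu uw]; rewrite ler_norml.
    by move: (ler_norm w) (ler_norm (- v)) (normr_ge0 v) (normr_ge0 w);
      rewrite normrN; lra.
  have := Hn _ _ _ xab; have := Hn _ _ _ ycd.
  move: (normr_ge0 a) (normr_ge0 b) (normr_ge0 c) (normr_ge0 d) => *.
  by apply: PK; lra.
Qed.

Lemma integrable_horner p (c d : R) B :
  measurable B -> B `<=` `[c, d] -> mu.-integrable B (fun y => (p.[y])%:E).
Proof.
move=> mB Bcd; apply: (@integrableS _ _ _ mu _ _ _ _ _ Bcd) => //.
apply: continuous_compact_integrable; first exact: segment_compact.
exact/continuous_subspaceT/continuous_horner.
Qed.

(** Fubini, after the restriction to [A] times [B] has been moved into the integrand: sections at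
    points outside [A] then integrate to zero. *)
Lemma integral2_iterated P (a b c d : R) A B :
  measurable A -> measurable B -> A `<=` `[a, b] -> B `<=` `[c, d] ->
  integral2 (A `*` B) (fun q => P.[q.1, q.2]) =
  \int[mu]_(x in A) \int[mu]_(y in B) P.[x, y].
Proof.
move=> mA mB Aab Bcd.
have iP := integrable_horner2 P mA mB Aab Bcd.
rewrite /integral2 /Rintegral integral_mkcond -integral12_prod_meas1;
  last first.
  by rewrite -integrable_mkcond//; exact: measurableX.
congr fine; rewrite [RHS]integral_mkcond; apply: eq_integral => x _.
rewrite /fubini_F patchE; case: ifPn => xA.
  rewrite fineK; last exact/integrable_fin_num/(integrable_horner _ mB Bcd).
  rewrite [RHS]integral_mkcond; apply: eq_integral => y _.
  by rewrite !patchE in_setX xA.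
rewrite integral0_eq// => y _.
by rewrite patchE in_setX (negbTE xA).
Qed.

(** Including or excluding end points does not change the integral; the quarters below are
    half-open. *)
Lemma Rintegral_horner p (a b : R) (s t : bool) :
  \int[mu]_(x in [set` Interval (BSide s a) (BSide t b)]) p.[x] =
  poly_int a b p.
Proof.
have mp : measurable_fun `]a, b[ (fun x => (p.[x])%:E).
  by apply/measurable_EFinP; exact: measurable_poly.
by congr fine; rewrite [LHS]integral_itv_bndoo// [RHS]integral_itv_bndoo.
Qed.

Lemma sub_itvcc (a b : R) (s t : bool) :
  [set` Interval (BSide s a) (BSide t b)] `<=` `[a, b].
Proof.
case: s; case: t => x /=; rewrite !in_itv/= => /andP[ax xb];
by apply/andP; split=> //; exact: ltW.
Qed.

Lemma poly_int_quadrature z k p (c r : R) :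
  (forall q : {poly R}, (size q <= k.+1)%N ->
     quadrature z q = poly_int (- 2^-1) 2^-1 q) ->
  (size p <= k.+1)%N -> 0 < r ->
  poly_int c (c + r) p =
  r * \sum_(a < size z) weight z a * p.[c + r * (z`_a + 2^-1)].
Proof.
move=> exact_z szp r_gt0.
(* Recentring: [c + r * (t + 1/2)] is the midpoint [c + r / 2] plus [r * t]. *)
have -> : poly_int c (c + r) p =
    poly_int ((c + r / 2) + r * - 2^-1) ((c + r / 2) + r * 2^-1) p.
  by rewrite mulrN addrK -addrA -splitr.
rewrite poly_int_affine ?half_itv//; congr (_ * _).
set g := _%:P + _; rewrite -exact_z.
  apply: eq_bigr => a _; congr (_ * _).
  by rewrite horner_comp hornerD hornerC hornerZ hornerX; congr _.[_]; field.
rewrite (leq_trans (size_comp_poly_leq _ _))// ltnS.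
have : (size g <= 2)%N.
  rewrite (leq_trans (size_polyD _ _))// geq_max (leq_trans (size_polyC_leq1
    _))//=.
  by rewrite (leq_trans (size_scale_leq _ _))// size_polyX.
move: (size g) (size p) szp => m l; nia.
Qed.

Lemma total_degree_swap k P :
  total_degree_le k P -> total_degree_le k (swapXY P).
Proof. by move=> Pk a b kab; rewrite coef_swapXY Pk// addnC. Qed.

Lemma size_horner_total k P x :
  total_degree_le k P -> (size P.[x%:P] <= k.+1)%N.
Proof.
move=> Pk; apply/leq_sizeP => j kj; rewrite horner_coef coef_sum big1// => i _.
by rewrite -polyC_exp coefMC Pk ?mul0r// ltn_addl.
Qed.

(** The total degree bounds the degree in each variable. The second rule is exact on each section,
    and its result is a polynomial [Q] in the first variable of degree at most [k], to which the
    first rule applies. *)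
Lemma integral2_tensor z1 z2 k P (c r d s : R) (b1 b2 b3 b4 : bool) :
  (forall q : {poly R}, (size q <= k.+1)%N ->
     quadrature z1 q = poly_int (- 2^-1) 2^-1 q) ->
  (forall q : {poly R}, (size q <= k.+1)%N ->
     quadrature z2 q = poly_int (- 2^-1) 2^-1 q) ->
  total_degree_le k P -> 0 < r -> 0 < s ->
  integral2 ([set` Interval (BSide b1 c) (BSide b2 (c + r))]
             `*` [set` Interval (BSide b3 d) (BSide b4 (d + s))])
            (fun q => P.[q.1, q.2]) =
  r * s * \sum_(a < size z1) \sum_(b < size z2) weight z1 a * weight z2 b *
     P.[c + r * (z1`_a + 2^-1), d + s * (z2`_b + 2^-1)].
Proof.
move=> exact1 exact2 Pk r_gt0 s_gt0.
rewrite (integral2_iterated P _ _ (@sub_itvcc _ _ _ _) (@sub_itvcc _ _ _ _))//.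
pose Q : {poly R} := s *: \sum_(b < size z2)
  weight z2 b *: (swapXY P).[(d + s * (z2`_b + 2^-1))%:P].
transitivity (\int[mu]_(x in [set` Interval (BSide b1 c) (BSide b2 (c + r))])
  Q.[x]).
  apply: eq_Rintegral => x _.
  rewrite Rintegral_horner (poly_int_quadrature _ exact2)//;
    last exact: size_horner_total.
  rewrite hornerZ horner_sum; congr (_ * _); apply: eq_bigr => b _.
  by rewrite hornerZ horner2_swapXY.
rewrite Rintegral_horner (poly_int_quadrature _ exact1)//; last first.
  rewrite (leq_trans (size_scale_leq _ _))// (leq_trans (size_sum _ _ _))//.
  apply/bigmax_leqP => b _; rewrite (leq_trans (size_scale_leq _ _))//.
  exact/size_horner_total/total_degree_swap.
rewrite -mulrA; congr (_ * _); rewrite mulr_sumr; apply: eq_bigr => a _.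
rewrite hornerZ horner_sum mulrCA; congr (_ * _); rewrite mulr_sumr.
by apply: eq_bigr => b _; rewrite hornerZ horner2_swapXY mulrA.
Qed.

End BivariateIntegral.

(** Integrability of the union is returned along with additivity, so that the lemma can be iterated
    over the four quarters, where [f] is only known piece by piece. *)
Lemma Rintegral_setU_pieces d (T : measurableType d) (R : realType)
    (mu : {measure set T -> \bar R}) (A B : set T) (f : T -> R) :
  measurable A -> measurable B -> [disjoint A & B] ->
  mu.-integrable A (EFin \o f) -> mu.-integrable B (EFin \o f) ->
  mu.-integrable (A `|` B) (EFin \o f) /\
  \int[mu]_(x in A `|` B) f x = \int[mu]_(x in A) f x + \int[mu]_(x in B) f x.
Proof.
move=> mA mB dAB fA fB.
have fAB : mu.-integrable (A `|` B) (EFin \o f).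
  have [mfA iA] := integrableP _ _ _ fA; have [mfB iB] := integrableP _ _ _ fB.
  have mfAB : measurable_fun (A `|` B) (EFin \o f) by apply/measurable_funU.
  apply/integrableP; split=> //; rewrite ge0_integral_setU//.
    exact: lte_add_pinfty.
  exact: measurableT_comp.
by split=> //; exact: Rintegral_setU.
Qed.

(** * Splitting a rectangle into quarters *)

Section Quarters.
Context {R : realType}.

Local Notation mu2 := (@lebesgue_measure R \x @lebesgue_measure R)%E.
Implicit Types (c d dx dy t : R) (l m : bool)
  (P : bool -> bool -> {poly {poly R}}).

(* The lower half is taken half-open, in accordance with the values on cell
   edges chosen in [primal_fun] and [dual_fun]. *)
Definition half_cell c dx l : interval R :=
  Interval (BLeft (c + l%:R * (dx / 2)))
           (BSide (~~ l) (c + l%:R * (dx / 2) + dx / 2)).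

Definition half_cell_point c dx l t : R :=
  c + l%:R * (dx / 2) + dx / 2 * (t + 2^-1).

Lemma half_cell_interior c dx l t : 0 < dx -> - 2^-1 < t < 2^-1 ->
  half_cell_point c dx l t \in half_cell c dx l.
Proof.
move=> dx0 /andP[t1 t2]; rewrite /half_cell /half_cell_point; case: l;
by rewrite in_itv/= ?mul1r ?mul0r; apply/andP; split; nra.
Qed.

(** This point is the end of the half that the two halves do not share; the fluxes are evaluated
    there. *)
Lemma half_cell_outer c dx l : 0 < dx -> c + l%:R * dx \in half_cell c dx l.
Proof.
by move=> dx0; case: l; rewrite in_itv/= ?mul1r ?mul0r; apply/andP; split; lra.
Qed.

Lemma half_cell_point_outer c dx l :
  half_cell_point c dx l (if l then 2^-1 else - 2^-1) = c + l%:R * dx.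
Proof. by rewrite /half_cell_point; case: l; rewrite ?mul1r ?mul0r; lra. Qed.

Lemma half_cellU c dx : 0 < dx ->
  [set` `[c, c + dx]] =
  [set` half_cell c dx false] `|` [set` half_cell c dx true].
Proof.
move=> dx0; apply/seteqP; split=> x /=; rewrite !in_itv/= mul0r mul1r.
  case: (ltP x (c + 0 + dx / 2)) => xc /andP[? ?]; [left|right]; apply/andP;
    split; lra.
by move=> [] /andP[? ?]; apply/andP; split; lra.
Qed.

Lemma half_cellI c dx x :
  x \in half_cell c dx false -> x \in half_cell c dx true -> False.
Proof. by rewrite !in_itv/= => /andP[_ x1] /andP[x2 _]; move: x1 x2; lra. Qed.

Lemma integral2_quarters (f : R * R -> R) P c d dx dy : 0 < dx -> 0 < dy ->
  (forall l m x y, x \in half_cell c dx l -> y \in half_cell d dy m ->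
     f (x, y) = (P l m).[x, y]) ->
  integral2 (`[c, c + dx] `*` `[d, d + dy]) f =
  \sum_(l : bool) \sum_(m : bool)
    integral2 ([set` half_cell c dx l] `*` [set` half_cell d dy m])
      (fun q => (P l m).[q.1, q.2]).
Proof.
move=> dx0 dy0 fP.
pose H l : set (measurableTypeR R) := [set` half_cell c dx l].
pose K m : set (measurableTypeR R) := [set` half_cell d dy m].
have mH l : measurable (H l) by exact: measurable_itv.
have mK m : measurable (K m) by exact: measurable_itv.
have mHK l m := measurableX (mH l) (mK m).
have fQ l m : {in H l `*` K m, f =1 (fun q => (P l m).[q.1, q.2])}.
  by move=> [x y] /set_mem[xH yK]; exact: fP.
have iP l m : mu2.-integrable (H l `*` K m) (EFin \o f).
  apply: (@eq_integrable _ _ _ mu2 _ (mHK l m)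
    (fun q => ((P l m).[q.1, q.2])%:E)).
    by move=> q qHK /=; rewrite (fQ l m).
  exact: (integrable_horner2 _ (mH l) (mK m) (@sub_itvcc _ _ _ _ _) (@sub_itvcc
    _ _ _ _ _)).
rewrite /integral2 (half_cellU c dx0) (half_cellU d dy0) -/(H false) -/(H true)
  -/(K false) -/(K true).
have dK : [disjoint K false & K true].
  by apply/disj_setPS => y [/half_cellI yK /yK].
have dH : [disjoint H false & H true].
  by apply/disj_setPS => x [/half_cellI xH /xH].
have boxE : (H false `|` H true) `*` (K false `|` K true) =
  (H false `*` K false `|` H false `*` K true)
  `|` (H true `*` K false `|` H true `*` K true).
  apply/seteqP; split=> -[x y].
    by move=> [[xH|xH] [yK|yK]]; [left; left|left; right|right; left|right;
      right].
  by move=> [[]|[]] [? ?]; split; (try by left); right.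
rewrite boxE.
have dHK l : [disjoint H l `*` K false & H l `*` K true].
  by apply/disj_setPS => -[x y] [[_ /half_cellI yK] [_ /yK]].
have [iP1 E1] := Rintegral_setU_pieces (mHK true false) (mHK true true) (dHK
  true)
  (iP true false) (iP true true).
have [iP0 E0] := Rintegral_setU_pieces (mHK false false) (mHK false true) (dHK
  false)
  (iP false false) (iP false true).
have [] := Rintegral_setU_pieces (measurableU _ _ (mHK false false) (mHK false
  true))
  (measurableU _ _ (mHK true false) (mHK true true)) _ iP0 iP1.
  apply/disj_setPS => -[x y] [xy0 xy1]; case: xy0 => -[+ _];
    case: xy1 => -[+ _];
  by move=> x1 /half_cellI/(_ x1).
move=> _ ->; rewrite E0 E1.
(* [big_bool] lists [true] first, whereas the pieces were split with [false] first. *)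
rewrite !big_bool/= addrC; congr (_ + _); rewrite addrC; congr (_ + _);
exact: eq_Rintegral (fQ _ _).
Qed.

End Quarters.

(** * Update on one cell *)

Section RectangleUpdate.
Context {R : realType}.
Variables (k N n : nat) (z zh : seq R).
Hypotheses (z_gauss : gauss_legendre_nodes N z).
Hypotheses (z_exact : quadrature_exact z (2 * k + 1)).
Hypotheses (n_gt0 : (0 < n)%N) (k_le : (k.+1 <= n.*2)%N).
Hypotheses (zh_lobatto : gauss_lobatto_nodes n.+1 zh).

Local Notation J := (@poly_int R (- 2^-1) 2^-1).

Let z_rule (q : {poly R}) : (size q <= k.+1)%N -> quadrature z q = J q.
Proof. by move=> szq; apply: z_exact; lia. Qed.

Let zh_rule (q : {poly R}) : (size q <= k.+1)%N -> quadrature zh q = J q.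
Proof. by move=> szq; apply: lobatto_exact zh_lobatto _ _ => //; lia. Qed.

Let z_ge0 a : (a < size z)%N -> 0 <= weight z a.
Proof. by move=> /(gauss_legendre_node z_gauss)[_ /ltW]. Qed.

Let zh_gt0 a : (a < size zh)%N -> 0 < weight zh a.
Proof. exact: (lobatto_weight_gt0 n_gt0 zh_lobatto). Qed.

Let size_zh : size zh = n.+1. Proof. by case: zh_lobatto. Qed.

(** Position in [zh] of the Gauss-Lobatto node on the outer edge of the half. *)
Definition outer_index (l : bool) := if l then n else 0%N.

Let outer_lt l : (outer_index l < size zh)%N.
Proof. by rewrite size_zh; case: l. Qed.

Let outer_node (c dx : R) l :
  half_cell_point c dx l zh`_(outer_index l) = c + l%:R * dx.
Proof.
rewrite -half_cell_point_outer; congr half_cell_point.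
by case: l => /=; [exact: lobatto_last n_gt0 zh_lobatto|exact: lobatto_first
  n_gt0 zh_lobatto].
Qed.

Let outer_weight l : weight zh (outer_index l) = weight zh 0.
Proof. by case: l => //; exact: lobatto_weight_sym n_gt0 zh_lobatto. Qed.

Lemma outer_term_le (F : nat -> R) l :
  (forall b, (b < size zh)%N -> 0 <= F b) ->
  weight zh 0 * F (outer_index l) <= \sum_(b < size zh) weight zh b * F b.
Proof.
move=> F0; rewrite (bigD1 (Ordinal (outer_lt l)))//= outer_weight lerDl.
by apply: sumr_ge0 => b _; rewrite mulr_ge0 ?F0// ltW ?zh_gt0.
Qed.

Variables (c d dx dy : R) (P : bool -> bool -> {poly {poly R}}).
Hypotheses (dx_gt0 : 0 < dx) (dy_gt0 : 0 < dy).
Hypothesis P_deg : forall l m, total_degree_le k (P l m).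
Hypothesis P_ge0 : forall l m a b, (a < size z)%N -> (b < size zh)%N ->
  0 <= (P l m).[half_cell_point c dx l z`_a, half_cell_point d dy m zh`_b] /\
  0 <= (P l m).[half_cell_point c dx l zh`_b, half_cell_point d dy m z`_a].

(** Normalized by the area of the whole rectangle, so that the four values add up to its average. *)
Let A l m := integral2 ([set` half_cell c dx l] `*` [set` half_cell d dy m])
  (fun q => (P l m).[q.1, q.2]) / (dx * dy).

Let Ex l m := \sum_(a < size z) weight z a *
  (P l m).[c + l%:R * dx, half_cell_point d dy m z`_a].
Let Ey l m := \sum_(a < size z) weight z a *
  (P l m).[half_cell_point c dx l z`_a, d + m%:R * dy].

(** Gauss-Lobatto in x and Gauss in y: only the Gauss-Lobatto node on the outer edge is kept. The
    factor 4 arises because a quarter has area dx dy / 4. *)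
Let Ex_le l m : weight zh 0 * Ex l m <= 4 * A l m.
Proof.
rewrite /A (integral2_tensor _ _ _ _ _ _ zh_rule z_rule) ?divr_gt0//.
have -> : forall s : R, 4 * (dx / 2 * (dy / 2) * s / (dx * dy)) = s.
  by move=> s; field; rewrite !gt_eqF.
rewrite exchange_big mulr_sumr; apply: ler_sum => a _.
have F0 b : (b < size zh)%N -> 0 <=
    (P l m).[half_cell_point c dx l zh`_b, half_cell_point d dy m z`_a].
  by move=> ltb; have [] := P_ge0 l m (ltn_ord a) ltb.
rewrite mulrCA -outer_node.
apply: le_trans (ler_wpM2l (z_ge0 (ltn_ord a)) (outer_term_le l F0)) _.
by rewrite mulr_sumr; apply: ler_sum => b _; rewrite mulrCA mulrA.
Qed.

Let Ey_le l m : weight zh 0 * Ey l m <= 4 * A l m.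
Proof.
rewrite /A (integral2_tensor _ _ _ _ _ _ z_rule zh_rule) ?divr_gt0//.
have -> : forall s : R, 4 * (dx / 2 * (dy / 2) * s / (dx * dy)) = s.
  by move=> s; field; rewrite !gt_eqF.
rewrite mulr_sumr; apply: ler_sum => a _.
have F0 b : (b < size zh)%N -> 0 <=
    (P l m).[half_cell_point c dx l z`_a, half_cell_point d dy m zh`_b].
  by move=> ltb; have [] := P_ge0 l m (ltn_ord a) ltb.
rewrite mulrCA -outer_node.
apply: le_trans (ler_wpM2l (z_ge0 (ltn_ord a)) (outer_term_le m F0)) _.
by rewrite mulr_sumr; apply: ler_sum => b _; rewrite -[leRHS]mulrA.
Qed.

Let outer_x_ge0 l m a : (a < size z)%N ->
  0 <= (P l m).[c + l%:R * dx, half_cell_point d dy m z`_a].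
Proof.
by move=> lta; rewrite -outer_node; have [] := P_ge0 l m lta (outer_lt l).
Qed.

Let outer_y_ge0 l m a : (a < size z)%N ->
  0 <= (P l m).[half_cell_point c dx l z`_a, d + m%:R * dy].
Proof.
by move=> lta; rewrite -outer_node; have [] := P_ge0 l m lta (outer_lt m).
Qed.

Variables (f u v : R * R -> R) (theta dt ax ay : R).
Hypothesis f_eq : forall l m x y,
  x \in half_cell c dx l -> y \in half_cell d dy m -> f (x, y) = (P l m).[x, y].
Hypothesis u_le : forall (l m : bool) a, (a < size z)%N ->
  `|u (c + l%:R * dx, half_cell_point d dy m z`_a)| <= ax.
Hypothesis v_le : forall (l m : bool) a, (a < size z)%N ->
  `|v (half_cell_point c dx l z`_a, d + m%:R * dy)| <= ay.
Hypotheses (dt_gt0 : 0 < dt) (theta_ge0 : 0 <= theta) (ax_ge0 : 0 <= ax)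
  (ay_ge0 : 0 <= ay).
Hypothesis cfl : dt / dx * ax + dt / dy * ay <= 4^-1 * theta * weight zh 0.

Let flux_le (s t h w r : R) : 0 <= h -> 0 <= w -> `|t| <= r -> `|s| = 1 ->
  w * (s * (h * t)) <= r * (w * h).
Proof.
move=> h0 w0 tr s1; rewrite [s * _]mulrCA !mulrA [r * w]mulrC -!mulrA
  ler_wpM2l//.
rewrite mulrC ler_wpM2r//.
by rewrite (le_trans (ler_norm _))// normrM s1 mul1r.
Qed.

(** The sign is that of the edge in the flux difference: plus on the right, minus on the left. The
    velocity bound covers both. *)
Let flux_x_le l m : \sum_(a < size z) weight z a *
    ((-1) ^+ (~~ l) *
     (let q := (c + l%:R * dx, half_cell_point d dy m z`_a) in f q * u q))
  <= ax * Ex l m.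
Proof.
rewrite mulr_sumr; apply: ler_sum => a _ /=; have lta := ltn_ord a.
have [za _] := gauss_legendre_node z_gauss lta.
rewrite (f_eq (l := l) (m := m)) ?half_cell_outer ?half_cell_interior//.
by rewrite flux_le ?outer_x_ge0 ?z_ge0 ?u_le ?normrX ?normrN1 ?expr1n.
Qed.

Let flux_y_le l m : \sum_(a < size z) weight z a *
    ((-1) ^+ (~~ m) *
     (let q := (half_cell_point c dx l z`_a, d + m%:R * dy) in f q * v q))
  <= ay * Ey l m.
Proof.
rewrite mulr_sumr; apply: ler_sum => a _ /=; have lta := ltn_ord a.
have [za _] := gauss_legendre_node z_gauss lta.
rewrite (f_eq (l := l) (m := m)) ?half_cell_outer ?half_cell_interior//.
by rewrite flux_le ?outer_y_ge0 ?z_ge0 ?v_le ?normrX ?normrN1 ?expr1n.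
Qed.

(* The average over a quarter dominates the end point terms of either tensor
   rule, and these terms dominate the fluxes through its outer edges. *)
Let quarter_ge0 l m :
  0 <= theta * A l m - dt / (2 * dx) * (ax * Ex l m)
       - dt / (2 * dy) * (ay * Ey l m).
Proof.
have w0 : 0 < weight zh 0 by apply: zh_gt0; rewrite size_zh.
have lx : dt / (2 * dx) = dt / dx / 2 by field; rewrite gt_eqF.
have ly : dt / (2 * dy) = dt / dy / 2 by field; rewrite gt_eqF.
rewrite lx ly; have X0 : 0 <= dt / dx * ax by rewrite mulr_ge0// divr_ge0// ltW.
have Y0 : 0 <= dt / dy * ay by rewrite mulr_ge0// divr_ge0// ltW.
have Ex0 : 0 <= Ex l m by apply: sumr_ge0 => a _;
  rewrite mulr_ge0 ?z_ge0 ?outer_x_ge0.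
have := Ex_le l m; have := Ey_le l m; move: cfl X0 Y0.
have -> : dt / dx / 2 * (ax * Ex l m) = dt / dx * ax * Ex l m / 2 by field;
  rewrite gt_eqF.
have -> : dt / dy / 2 * (ay * Ey l m) = dt / dy * ay * Ey l m / 2 by field;
  rewrite gt_eqF.
move: (dt / dx * ax) (dt / dy * ay) (A l m) (Ex l m) (Ey l m) (weight zh 0) w0
  Ex0.
move=> X Y M ex ey w w0 ex0 cflw X0 Y0 ey_le ex_le.
(* After multiplication by [w], the edge sums are bounded through [ex_le] and [ey_le] by multiples
   of [M], and the CFL condition bounds these by [theta * M * w]. *)
rewrite -(pmulr_lge0 _ w0).
have hx : X * (w * ex) <= X * (4 * M) by rewrite ler_wpM2l.
have hy : Y * (w * ey) <= Y * (4 * M) by rewrite ler_wpM2l.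
have M0 : 0 <= M by have := mulr_ge0 (ltW w0) ex0; lra.
have hM : (X + Y) * (4 * M) <= 4^-1 * theta * w * (4 * M) by rewrite
  ler_wpM2r//; lra.
have : 0 <= theta * M * w by rewrite !mulr_ge0// ltW.
by lra.
Qed.

(** Stated for an arbitrary rectangle, so that it serves the primal and the dual update alike; it
    covers all terms except the one with factor 1 - theta. *)
Lemma rectangle_update_ge0 :
  0 <= theta / (dx * dy) * integral2 (`[c, c + dx] `*` `[d, d + dy]) f
  - dt / (2 * dx) *
    (\sum_(m : bool) \sum_(a < size z) weight z a *
      (let F x := let q := (x, half_cell_point d dy m z`_a) in f q * u q in
       F (c + dx) - F c))
  - dt / (2 * dy) *
    (\sum_(l : bool) \sum_(a < size z) weight z a *
      (let G y := let q := (half_cell_point c dx l z`_a, y) in f q * v q in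
       G (d + dy) - G d)).
Proof.
rewrite (integral2_quarters dx_gt0 dy_gt0 f_eq).
(* The flux difference across the rectangle is distributed over its left and right quarters, one
   outer edge each. *)
have splitx m : \sum_(a < size z) weight z a *
      (let F x := let q := (x, half_cell_point d dy m z`_a) in f q * u q in
       F (c + dx) - F c) <= ax * Ex true m + ax * Ex false m.
  apply: le_trans (lerD (flux_x_le true m) (flux_x_le false m)).
  rewrite -big_split/=; apply: ler_sum => a _; rewrite expr0 expr1 mul1r mulN1r.
  by rewrite mul1r mul0r addr0 mulrBr mulrN.
have splity l : \sum_(a < size z) weight z a *
      (let G y := let q := (half_cell_point c dx l z`_a, y) in f q * v q in
       G (d + dy) - G d) <= ay * Ey l true + ay * Ey l false.
  apply: le_trans (lerD (flux_y_le l true) (flux_y_le l false)).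
  rewrite -big_split/=; apply: ler_sum => a _; rewrite expr0 expr1 mul1r mulN1r.
  by rewrite mul1r mul0r addr0 mulrBr mulrN.
have -> : theta / (dx * dy) * \sum_(l : bool) \sum_(m : bool)
    integral2 ([set` half_cell c dx l] `*` [set` half_cell d dy m])
      (fun q => (P l m).[q.1, q.2]) =
    theta * (A true true + A true false + (A false true + A false false)).
  by rewrite !big_bool/= -!mulrDl -mulrA [_^-1 * _]mulrC.
rewrite (big_bool _ (fun m => \sum_(a < size z) _)).
rewrite (big_bool _ (fun l => \sum_(a < size z) _))/=.
have tx : 0 <= dt / (2 * dx) by rewrite divr_ge0 ?mulr_ge0 ?ltW.
have ty : 0 <= dt / (2 * dy) by rewrite divr_ge0 ?mulr_ge0 ?ltW.
have := addr_ge0 (addr_ge0 (quarter_ge0 true true) (quarter_ge0 true false))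
                 (addr_ge0 (quarter_ge0 false true) (quarter_ge0 false false)).
have := ler_wpM2l tx (lerD (splitx true) (splitx false)).
have := ler_wpM2l ty (lerD (splity true) (splity false)).
move: (A true true) (A true false) (A false true) (A false false) => ? ? ? ? /=.
by lra.
Qed.

End RectangleUpdate.

(** * Overlapping grids *)

Section GridCells.
Context {R : realType}.
Variable X : uniform_grid R.
Hypothesis X_gt0 : 0 < spacing X.
Implicit Types (i : int) (l : bool) (t x : R).

Lemma nodeB1 i : node X (i - 1) = node X i - spacing X.
Proof. by rewrite /node rmorphB/=; lra. Qed.

Lemma midnodeE i : midnode X i = node X i + spacing X / 2.
Proof. by rewrite /midnode /node rmorphD/=; lra. Qed.

Lemma dual_index_eq i x : node X (i - 1) <= x < node X i -> dual_index X x = i.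
Proof.
rewrite nodeB1 /dual_index /node => /andP[x1 x2].
rewrite (@floor_def _ _ (i - 1)) ?subrK// rmorphB/=.
by rewrite ler_pdivlMr// ltr_pdivrMr//; apply/andP; split; lra.
Qed.

Lemma primal_index_eq i x :
  midnode X (i - 1) <= x < midnode X i -> primal_index X x = i.
Proof.
rewrite !midnodeE nodeB1 /primal_index /node => /andP[x1 x2].
apply: floor_def; rewrite rmorphD/= -lerBlDr -ltrBrDr ler_pdivlMr//
  ltr_pdivrMr//.
by apply/andP; split; lra.
Qed.

(** The upper bound is strict, as [floor] requires: the lower half excludes the node where it ends,
    and the upper half ends in the interior of the dual interval. *)
Lemma half_cell_dual i l x :
  x \in half_cell (midnode X (i - 1)) (spacing X) l ->
  node X (dual_of_half i l - 1) <= x < node X (dual_of_half i l).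
Proof.
move: X_gt0; rewrite midnodeE !nodeB1 /dual_of_half.
by case: l; rewrite ?addr0 ?mul0r ?mul1r in_itv/= /node ?rmorphD/= ?mul1r ?mul0r
  => s0 /andP[x1 x2]; apply/andP; split; lra.
Qed.

(** The first half of a dual interval is the second half of the preceding primal interval, whence
    the negation of [l]. *)
Lemma half_cell_primal i l x : x \in half_cell (node X (i - 1)) (spacing X) l ->
  midnode X (i - (~~ l)%:Z - 1) <= x < midnode X (i - (~~ l)%:Z).
Proof.
move: X_gt0; rewrite !midnodeE !nodeB1.
by case: l; rewrite ?subr0 in_itv/= /node ?rmorphB/= ?mul1r ?mul0r
  => s0 /andP[x1 x2]; apply/andP; split; lra.
Qed.

Lemma half_pointE i l t :
  half_point X i l t = half_cell_point (midnode X (i - 1)) (spacing X) l t.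
Proof.
rewrite /half_point /half_left /half_right /half_cell_point !midnodeE nodeB1.
by case: l; rewrite ?mul1r ?mul0r; lra.
Qed.

Lemma dual_half_pointE i l t :
  dual_half_point X i l t = half_cell_point (node X (i - 1)) (spacing X) l t.
Proof.
rewrite /dual_half_point !half_pointE /half_cell_point !midnodeE !nodeB1.
by case: l; rewrite ?mul1r ?mul0r; lra.
Qed.

Lemma dual_half_point_half i l t :
  dual_half_point X i l t = half_point X (i - (~~ l)%:Z) (~~ l) t.
Proof. by case: l; rewrite /= ?subr0. Qed.

End GridCells.

Section SupNorm.
Context {R : realType}.

Lemma sup_norm_ub (A : set (R * R)) (u : R * R -> R) q :
  A q -> (`|u q|%:E <= sup_norm A u)%E.
Proof. by move=> Aq; apply: ereal_sup_ubound; exists q. Qed.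

(** The sup norms live in the extended reals; the CFL condition has a finite right-hand side and
    positive coefficients, so it forces them to be finite. *)
Lemma weighted_sum_fin (lx ly w : R) (a b : \bar R) : 0 < lx -> 0 < ly ->
  (0 <= a)%E -> (0 <= b)%E -> (lx%:E * a + ly%:E * b <= w%:E)%E ->
  exists r s : R, [/\ a = r%:E, b = s%:E & lx * r + ly * s <= w].
Proof.
move=> lx0 ly0; case: a => [r| |]//; case: b => [s| |]// _ _; last 3 first.
- by rewrite gt0_muley ?lte_fin// addey.
- by rewrite gt0_muley ?lte_fin// addye.
- by rewrite !gt0_muley ?lte_fin.
by rewrite -!EFinM -EFinD lee_fin; exists r, s.
Qed.

End SupNorm.

Unset Implicit Arguments.

Theorem proposition3p2 (R : realType)
  (* grids, and the cells carrying data *)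
  (X Y : uniform_grid R) (X_gt0 : 0 < spacing X) (Y_gt0 : 0 < spacing Y)
  (IC ID : set (int * int))
  (* quadrature *)
  (k : nat) (k_ge1 : (1 <= k)%N)
  (N Nh : nat) (z zh : seq R)
  (z_gauss : gauss_legendre_nodes N z)
  (z_exact : quadrature_exact z (2 * k + 1))
  (Nh_ge2 : (2 <= Nh)%N) (Nh_k : (k <= 2 * Nh - 3)%N)
  (zh_lobatto : gauss_lobatto_nodes Nh zh)
  (* discrete functions, indexed by the time level *)
  (hC hD : nat -> int -> int -> {poly {poly R}})
  (uC vC uD vD : nat -> R * R -> R)
  (dt tau : nat -> R) (n : nat)
  (hC_deg : forall i j, IC (i, j) -> total_degree_le k (hC n i j))
  (hD_deg : forall i j, ID (i, j) -> total_degree_le k (hD n i j))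
  (uC_poly : continuous_piecewise_poly k (primal_cell X Y) IC (uC n))
  (vC_poly : continuous_piecewise_poly k (primal_cell X Y) IC (vC n))
  (uD_poly : continuous_piecewise_poly k (dual_cell X Y) ID (uD n))
  (vD_poly : continuous_piecewise_poly k (dual_cell X Y) ID (vD n))
  (dt_gt0 : 0 < dt n) (tau_gt0 : 0 < tau n) :
  let theta := dt n / tau n in
  let averageC (s : nat) (i j : int) :=
    cell_average X Y (primal_cell X Y i j) (primal_fun X Y (hC s)) in
  let averageD (s : nat) (i j : int) :=
    cell_average X Y (dual_cell X Y i j) (dual_fun X Y (hD s)) in
  let lambda_x := dt n / spacing X in
  let lambda_y := dt n / spacing Y in
  let normC := sup_norm (cells_union (primal_cell X Y) IC) in
  let normD := sup_norm (cells_union (dual_cell X Y) ID) in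
  let a_x := maxe (normC (uC n)) (normD (uD n)) in
  let a_y := maxe (normC (vC n)) (normD (vD n)) in
  0 <= theta <= 1 ->
  (forall i j, IC (i, j) -> 0 <= averageC n i j) ->
  (forall i j, ID (i, j) -> 0 <= averageD n i j) ->
  (forall i j, primal_updatable IC ID i j ->
     averageC n.+1 i j =
     primal_update X Y z theta (dt n) (hC n) (hD n) (uD n) (vD n) i j) ->
  (forall i j, dual_updatable IC ID i j ->
     averageD n.+1 i j =
     dual_update X Y z theta (dt n) (hC n) (hD n) (uC n) (vC n) i j) ->
  (forall (i j : int) (l m : bool) (q : R * R),
     quadrature_set X Y z zh i j l m q ->
     (IC (i, j) -> 0 <= primal_value (hC n) i j q) /\
     (ID (dual_of_half i l, dual_of_half j m) ->
        0 <= dual_value (hD n) i j l m q)) ->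
  (lambda_x%:E * a_x + lambda_y%:E * a_y
     <= (4^-1 * theta * weight zh 0)%:E)%E ->
  (forall i j, primal_updatable IC ID i j -> 0 <= averageC n.+1 i j) /\
  (forall i j, dual_updatable IC ID i j -> 0 <= averageD n.+1 i j).
Proof.
move=> theta averageC averageD lambda_x lambda_y normC normD a_x a_y.
move=> /andP[theta_ge0 theta_le1] avgC_ge0 avgD_ge0 updC updD h_ge0 cfl.
have [n' NhE n'_gt0] : exists2 n', Nh = n'.+1 & (0 < n')%N by exists Nh.-1; lia.
rewrite NhE in zh_lobatto.
(* With [Nh = n' + 1], the bound 2 Nh - 3 is the exactness degree 2n' - 1; truncated subtraction is
   harmless since [Nh] is at least 2. *)
have k_le : (k.+1 <= n'.*2)%N by lia.
have node_in (Z : uniform_grid R) i l (w : seq R) a : (a < size w)%N ->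
    half_nodes Z w i l (half_point Z i l w`_a).
  by move=> lta; apply: map_f; rewrite mem_nth.
have sup_ge0 (A : set (R * R)) (u : R * R -> R) q :
    A q -> (0 <= sup_norm A u)%E.
  by move=> Aq; apply: le_trans (sup_norm_ub u Aq); rewrite lee_fin.
have z_in a : (a < size z)%N -> - 2^-1 < z`_a < 2^-1.
  by move=> /(gauss_legendre_node z_gauss)[].
(* A point [q] carrying data is required because the supremum over an empty set is minus infinity;
   with it [a_x] and [a_y] are nonnegative. *)
have bounds q :
    cells_union (primal_cell X Y) IC q \/ cells_union (dual_cell X Y) ID q ->
    exists ax ay : R, [/\ 0 <= ax, 0 <= ay,
      forall q, cells_union (primal_cell X Y) IC q ->
        `|uC n q| <= ax /\ `|vC n q| <= ay,
      forall q, cells_union (dual_cell X Y) ID q ->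
        `|uD n q| <= ax /\ `|vD n q| <= ay &
      lambda_x * ax + lambda_y * ay <= 4^-1 * theta * weight zh 0].
  move=> q_in.
  have [ax0 ay0] : (0 <= a_x)%E /\ (0 <= a_y)%E.
    by split; rewrite le_max; case: q_in => q_in;
      rewrite (sup_ge0 _ _ _ q_in) ?orbT.
  have [ax [ay [axE ayE cflR]]] :=
    weighted_sum_fin (divr_gt0 dt_gt0 X_gt0) (divr_gt0 dt_gt0 Y_gt0) ax0 ay0
      cfl.
  exists ax, ay; split=> //.
  - by rewrite -lee_fin -axE.
  - by rewrite -lee_fin -ayE.
  - move=> r r_in; rewrite -!lee_fin -axE -ayE !le_max.
    by rewrite !(sup_norm_ub _ r_in).
  - move=> r r_in; rewrite -!lee_fin -axE -ayE !le_max.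
    by rewrite !(sup_norm_ub _ r_in) !orbT.
split=> i j ijU.
- rewrite updC// /primal_update.
  have [ICij IDlm] := ijU.
  have in_dual l m x y : x \in half_cell (midnode X (i - 1)) (spacing X) l ->
      y \in half_cell (midnode Y (j - 1)) (spacing Y) m ->
      cells_union (dual_cell X Y) ID (x, y).
    move=> /(half_cell_dual X_gt0)/andP[x1 /ltW x2] /(half_cell_dual
      Y_gt0)/andP[y1 /ltW y2].
    exists (dual_of_half i l, dual_of_half j m) => //.
    by split; rewrite /= in_itv/= ?x1 ?y1.
  (* The lower left corner of the cell is the point carrying data. *)
  have [ax [ay [ax_ge0 ay_ge0 _ uv_le cflR]]] := bounds _ (or_intror
    (in_dual _ _ _ _ (half_cell_outer _ false X_gt0) (half_cell_outer _ false
      Y_gt0))).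
  (* The old average enters with the nonnegative factor 1 - theta and is split off. *)
  rewrite -!addrA; apply: addr_ge0.
    by rewrite mulr_ge0 ?subr_ge0// avgC_ge0.
  rewrite addrA /primal_cell.
  have -> : midnode X i = midnode X (i - 1) + spacing X.
    by rewrite !midnodeE nodeB1; lra.
  have -> : midnode Y j = midnode Y (j - 1) + spacing Y.
    by rewrite !midnodeE nodeB1; lra.
  under eq_bigr do under eq_bigr do rewrite half_pointE.
  under [X in _ - _ * X]eq_bigr do under eq_bigr do rewrite half_pointE.
  apply: (rectangle_update_ge0 z_gauss z_exact n'_gt0 k_le zh_lobatto X_gt0
    Y_gt0
    (P := fun l m => hD n (dual_of_half i l) (dual_of_half j m))
    (f := dual_fun X Y (hD n)) (u := uD n) (v := vD n) _ _ _ _ _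
    dt_gt0 theta_ge0 ax_ge0 ay_ge0 cflR).
  + by move=> l m; exact: hD_deg.
  + move=> l m a b lta ltb; rewrite -!half_pointE; split.
      have [|_ ->//] := h_ge0 i j l m (half_point X i l z`_a, half_point Y j m
        zh`_b).
      by left; split; apply: node_in.
    have [|_ ->//] := h_ge0 i j l m (half_point X i l zh`_b, half_point Y j m
      z`_a).
    by right; split; apply: node_in.
  + move=> l m x y /(half_cell_dual X_gt0) xl /(half_cell_dual Y_gt0) ym.
    by rewrite /dual_fun (dual_index_eq X_gt0 xl) (dual_index_eq Y_gt0 ym).
  + move=> l m a lta.
    have ym := half_cell_interior (midnode Y (j - 1)) m Y_gt0 (z_in a lta).
    by have [] := uv_le _ (in_dual _ _ _ _ (half_cell_outer _ l X_gt0) ym).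
  + move=> l m a lta.
    have xl := half_cell_interior (midnode X (i - 1)) l X_gt0 (z_in a lta).
    by have [] := uv_le _ (in_dual _ _ _ _ xl (half_cell_outer _ m Y_gt0)).
- rewrite updD// /dual_update.
  have [IDij IClm] := ijU.
  have in_primal l m x y : x \in half_cell (node X (i - 1)) (spacing X) l ->
      y \in half_cell (node Y (j - 1)) (spacing Y) m ->
      cells_union (primal_cell X Y) IC (x, y).
    move=> /(half_cell_primal X_gt0)/andP[x1 /ltW x2].
    move=> /(half_cell_primal Y_gt0)/andP[y1 /ltW y2].
    exists (i - (~~ l)%:Z, j - (~~ m)%:Z) => //.
    by split; rewrite /= in_itv/= ?x1 ?y1.
  have [ax [ay [ax_ge0 ay_ge0 uv_le _ cflR]]] := bounds _ (or_introl
    (in_primal _ _ _ _ (half_cell_outer _ false X_gt0) (half_cell_outer _ false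
      Y_gt0))).
  rewrite -!addrA; apply: addr_ge0.
    by rewrite mulr_ge0 ?subr_ge0// avgD_ge0.
  rewrite addrA /dual_cell.
  have -> : node X i = node X (i - 1) + spacing X by rewrite nodeB1 subrK.
  have -> : node Y j = node Y (j - 1) + spacing Y by rewrite nodeB1 subrK.
  under eq_bigr do (rewrite mulr_sumr; under eq_bigr do rewrite
    dual_half_pointE).
  under [X in _ - _ * X]eq_bigr do
    (rewrite mulr_sumr; under eq_bigr do rewrite dual_half_pointE).
  (* The dual update sums over nodes first and halves second; the rectangle lemma has the opposite
     order. *)
  rewrite exchange_big [X in _ - _ * X]exchange_big/=.
  apply: (rectangle_update_ge0 z_gauss z_exact n'_gt0 k_le zh_lobatto X_gt0
    Y_gt0
    (P := fun l m => hC n (i - (~~ l)%:Z) (j - (~~ m)%:Z))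
    (f := primal_fun X Y (hC n)) (u := uC n) (v := vC n) _ _ _ _ _
    dt_gt0 theta_ge0 ax_ge0 ay_ge0 cflR).
  + by move=> l m; apply: hC_deg; exact: IClm.
  + move=> l m a b lta ltb; rewrite -!dual_half_pointE !dual_half_point_half;
    split.
      have [|+ _] := h_ge0 (i - (~~ l)%:Z) (j - (~~ m)%:Z) (~~ l) (~~ m)
        (half_point X (i - (~~ l)%:Z) (~~ l) z`_a,
         half_point Y (j - (~~ m)%:Z) (~~ m) zh`_b).
        by left; split; apply: node_in.
      by apply; exact: IClm.
    have [|+ _] := h_ge0 (i - (~~ l)%:Z) (j - (~~ m)%:Z) (~~ l) (~~ m)
      (half_point X (i - (~~ l)%:Z) (~~ l) zh`_b,
       half_point Y (j - (~~ m)%:Z) (~~ m) z`_a).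
      by right; split; apply: node_in.
    by apply; exact: IClm.
  + move=> l m x y /(half_cell_primal X_gt0) xl /(half_cell_primal Y_gt0) ym.
    by rewrite /primal_fun (primal_index_eq X_gt0 xl) (primal_index_eq Y_gt0
      ym).
  + move=> l m a lta.
    have ym := half_cell_interior (node Y (j - 1)) m Y_gt0 (z_in a lta).
    by have [] := uv_le _ (in_primal _ _ _ _ (half_cell_outer _ l X_gt0) ym).
  + move=> l m a lta.
    have xl := half_cell_interior (node X (i - 1)) l X_gt0 (z_in a lta).
    by have [] := uv_le _ (in_primal _ _ _ _ xl (half_cell_outer _ m Y_gt0)).
Qed.
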